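(* In the maximal tensor product of two hexagon systems, the extreme entangled states form exactly six equivalence classes under local reversible transformations. With $r_6=\sqrt{\sec(\pi/6)}$, representatives of the six classes are $$\Phi_I=\begin{pmatrix}\frac{\sqrt3}{2}&\frac12&0\\ \frac12&-\frac{\sqrt3}{2}&0\\0&0&1\end{pmatrix},\quad \Phi_{II}=\begin{pmatrix}\frac{1}{15r_6^2}&\frac{7}{10}&\frac{2}{3r_6^3}\\ \frac{7}{10}&\frac{1}{5r_6^2}&\frac{3}{5r_6}\\ \frac{2}{3r_6^3}&\frac{3}{5r_6}&1\end{pmatrix},\quad \Phi_{III}=\begin{pmatrix}\frac{1}{3r_6^2}&\frac{1}{r_6^4}&\frac{2}{3r_6^3}\\ \frac{1}{r_6^4}&0&\frac{1}{2r_6}\\ \frac{2}{3r_6^3}&\frac{1}{2r_6}&1\end{pmatrix},$$ $$\Phi_{IV}=\begin{pmatrix}\frac{1}{7r_6^2}&\frac{9}{14}&\frac{10}{21r_6^3}\\ \frac{11}{14}&\frac{1}{7r_6^2}&\frac{5}{7r_6}\\ \frac{6}{7r_6^3}&\frac{3}{7r_6}&1\end{pmatrix},\quad \Phi_{V}=\begin{pmatrix}\frac{1}{7r_6^2}&\frac{11}{14}&\frac{6}{7r_6^3}\\ \frac{9}{14}&\frac{1}{7r_6^2}&\frac{3}{7r_6}\\ \frac{10}{21r_6^3}&\frac{5}{7r_6}&1\end{pmatrix},\quad \Phi_{VI}=\begin{pmatrix}\frac{-1}{2r_6^2}&\frac{-1}{r_6^4}&\frac{1}{3r_6^3}\\ \frac{-1}{r_6^4}&\frac{1}{2r_6^2}&\frac{-1}{2r_6}\\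 \frac{1}{3r_6^3}&\frac{-1}{2r_6}&1\end{pmatrix}.$$
   Context: Hexagon model. The elementary state space is the convex hull in $\mathbb R^3$ of the pure states $\omega_i=(r_6\cos\frac{2\pi i}{6},\,r_6\sin\frac{2\pi i}{6},\,1)^{\mathrm T}$, $i=1,\dots,6$. The unit effect is $u=(0,0,1)^{\mathrm T}$; the extremal effects other than $0$ and $u$ are $e_i=\frac12(r_6\cos\frac{(2i-1)\pi}{6},\,r_6\sin\frac{(2i-1)\pi}{6},\,1)^{\mathrm T}$, $i=1,\dots,6$. The state space of the maximal tensor product is the polytope of real $3\times3$ matrices $\Phi$ with $u^{\mathrm T}\Phi u=1$ (i.e. $\Phi_{33}=1$) and $e_i^{\mathrm T}\Phi e_j\ge 0$ for all $i,j\in\{1,\dots,6\}$. An extreme point is entangled if it is not one of the product states $\omega_i\omega_j^{\mathrm T}$. Reversible transformations of one hexagon are the $12$ matrices $\mathcal T_k^s=\begin{pmatrix}\cos\frac{2\pi k}{6}&-s\sin\frac{2\pi k}{6}&0\\ \sin\frac{2\pi k}{6}&s\cos\frac{2\pi k}{6}&0\\0&0&1\end{pmatrix}$, $k\in\{1,\dots,6\}$, $s=\pm1$. Local reversible transformations act by $\Phi\mapsto \mathcal T_{k_1}^{s_1}\,\Phi\,(\mathcal T_{k_2}^{s_2})^{\mathrm T}$ (the swap of the two parties, i.e. transposition, is not included). Two entangled states are equivalent if some local reversible transformation maps one to the other. *)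

(* Defs.v *)
From mathcomp Require Import all_boot all_order all_algebra.
From mathcomp Require Import boolp classical_sets functions cardinality.
From mathcomp Require Import reals trigo.

Set Implicit Arguments.
Unset Strict Implicit.
Unset Printing Implicit Defensive.

Import Order.TTheory GRing.Theory Num.Theory.

Local Open Scope classical_set_scope.
Local Open Scope ring_scope.

Definition extreme_points (R : realType) (V : lmodType R) (A : set V) : set V :=
  [set x | A x /\
     forall (y z : V) (t : R), A y -> A z -> 0 < t < 1 ->
       x = t *: y + (1 - t) *: z -> y = x /\ z = x].

Section Hexagon.
Variable R : realType.

Definition col3 (s : seq R) : 'cV[R]_3 := \col_(i < 3) s`_i.

Definition mx3 (rows : seq (seq R)) : 'M[R]_3 :=
  \matrix_(i < 3, j < 3) (nth [::] rows i)`_j.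

Definition r6 : R := Num.sqrt ((cos (pi / 6))^-1).

(* Pure states, extremal effects and rotations are indexed by a natural number,
   restricted to 1, ..., 6 by the predicate [hex_index] wherever they are used. *)
Definition hex_index (i : nat) : bool := (1 <= i <= 6)%N.

Definition pure_state (i : nat) : 'cV[R]_3 :=
  col3 [:: r6 * cos (2 * pi * i%:R / 6); r6 * sin (2 * pi * i%:R / 6); 1].

Definition unit_effect : 'cV[R]_3 := col3 [:: 0; 0; 1].

Definition effect (i : nat) : 'cV[R]_3 :=
  2^-1 *: col3 [:: r6 * cos ((2 * i%:R - 1) * pi / 6);
                   r6 * sin ((2 * i%:R - 1) * pi / 6); 1].

Definition outcome (e : 'cV[R]_3) (Phi : 'M[R]_3) (f : 'cV[R]_3) : R :=
  (e^T *m Phi *m f) 0 0.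

Definition max_tensor_states : set 'M[R]_3 :=
  [set Phi | outcome unit_effect Phi unit_effect = 1 /\
     forall i j : nat, hex_index i -> hex_index j ->
       0 <= outcome (effect i) Phi (effect j)].

Definition product_states : set 'M[R]_3 :=
  [set Phi | exists i j : nat, [/\ hex_index i, hex_index j &
     Phi = pure_state i *m (pure_state j)^T]].

Definition extreme_entangled : set 'M[R]_3 :=
  extreme_points max_tensor_states `\` product_states.

Definition hex_transformation (k : nat) (s : R) : 'M[R]_3 :=
  let a := 2 * pi * k%:R / 6 in
  mx3 [:: [:: cos a; - s * sin a; 0];
          [:: sin a;   s * cos a; 0];
          [:: 0;       0;         1]].

Definition reversible : set 'M[R]_3 :=
  [set T | exists (k : nat) (s : R),
     [/\ hex_index k, s = 1 \/ s = -1 & T = hex_transformation k s]].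

Definition locally_equivalent (Phi Psi : 'M[R]_3) : Prop :=
  exists T1 T2 : 'M[R]_3,
    [/\ reversible T1, reversible T2 & Psi = T1 *m Phi *m T2^T].

Definition entangled_class (Phi : 'M[R]_3) : set 'M[R]_3 :=
  [set Psi | extreme_entangled Psi /\ locally_equivalent Phi Psi].

Definition entangled_classes : set (set 'M[R]_3) :=
  entangled_class @` extreme_entangled.

Definition Phi_I : 'M[R]_3 := mx3
  [:: [:: Num.sqrt 3 / 2; 1 / 2;              0];
      [:: 1 / 2;          - (Num.sqrt 3 / 2); 0];
      [:: 0;              0;                  1]].

Definition Phi_II : 'M[R]_3 := mx3
  [:: [:: 1 / (15 * r6 ^+ 2); 7 / 10;            2 / (3 * r6 ^+ 3)];
      [:: 7 / 10;             1 / (5 * r6 ^+ 2); 3 / (5 * r6)];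
      [:: 2 / (3 * r6 ^+ 3);  3 / (5 * r6);      1]].

Definition Phi_III : 'M[R]_3 := mx3
  [:: [:: 1 / (3 * r6 ^+ 2); 1 / r6 ^+ 4;  2 / (3 * r6 ^+ 3)];
      [:: 1 / r6 ^+ 4;       0;            1 / (2 * r6)];
      [:: 2 / (3 * r6 ^+ 3); 1 / (2 * r6); 1]].

Definition Phi_IV : 'M[R]_3 := mx3
  [:: [:: 1 / (7 * r6 ^+ 2); 9 / 14;            10 / (21 * r6 ^+ 3)];
      [:: 11 / 14;           1 / (7 * r6 ^+ 2); 5 / (7 * r6)];
      [:: 6 / (7 * r6 ^+ 3); 3 / (7 * r6);      1]].

Definition Phi_V : 'M[R]_3 := mx3
  [:: [:: 1 / (7 * r6 ^+ 2);   11 / 14;           6 / (7 * r6 ^+ 3)];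
      [:: 9 / 14;              1 / (7 * r6 ^+ 2); 3 / (7 * r6)];
      [:: 10 / (21 * r6 ^+ 3); 5 / (7 * r6);      1]].

Definition Phi_VI : 'M[R]_3 := mx3
  [:: [:: - 1 / (2 * r6 ^+ 2); - 1 / r6 ^+ 4;      1 / (3 * r6 ^+ 3)];
      [:: - 1 / r6 ^+ 4;       1 / (2 * r6 ^+ 2);  - 1 / (2 * r6)];
      [:: 1 / (3 * r6 ^+ 3);   - 1 / (2 * r6);     1]].

Definition representative (i : 'I_6) : 'M[R]_3 :=
  nth 0 [:: Phi_I; Phi_II; Phi_III; Phi_IV; Phi_V; Phi_VI] i.

End Hexagon.

Arguments entangled_classes R : clear implicits.

(* Main.v *)
Require Import Defs.
From Stdlib Require Import ZArith.
From mathcomp Require Import all_boot all_order all_algebra.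
From mathcomp Require Import ring lra ssrZ zify.
From mathcomp Require Import boolp classical_sets functions cardinality.
From mathcomp Require Import reals trigo.

(** A state Phi is determined by its 6x6 table of outcomes e_i^T Phi e_j, and the
    tables of the states are cut out of a 9-dimensional space by the nonnegativity
    of the 36 entries.  The effects e_1, e_3, e_5 form a basis, so nonnegativity of
    the nine entries indexed by odd i and j defines a simplicial cone; the other 27
    inequalities are imposed one at a time by the double description method, computed
    on integer rays.  The result is a list of 552 rays such that the zeros
    of every state are also zeros of some ray of the list.  If the zeros of an
    extreme state Phi are zeros of a state Psi, then Phi + c (Phi - Psi) is a state
    for small c > 0, so Psi = Phi.  Hence every extreme state is proportional to one
    of the 552 rays, and these are the 36 product states together with the orbits
    of the six representatives under the permutations of rows and columns induced
    by the local reversible transformations.  A representative is extreme because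
    its ray is the only one in the list with these zeros; the orbits are told apart
    by the positions of their zeros. *)

Set Implicit Arguments.
Unset Strict Implicit.
Unset Printing Implicit Defensive.

Import Order.TTheory GRing.Theory Num.Theory.

Local Open Scope classical_set_scope.
Local Open Scope ring_scope.
Local Delimit Scope Z_scope with ZZ.

(** * Polyhedral cones *)

Section Cone.
Variable R : realFieldType.
Implicit Types (K : set (nat -> R)) (x y : nat -> R) (ks : seq nat).

(** Combinations are built one generator at a time, so that facts about the spanned cone go by
    induction on the combination. *)
Inductive cone K : (nat -> R) -> Prop :=
| Cone0 : cone K (fun=> 0)
| ConeD c s x : 0 <= c -> K s -> cone K x -> cone K (fun i => c * s i + x i).

Lemma cone_ext K x y : x =1 y -> cone K x -> cone K y.
Proof. by move=> /funext ->. Qed.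

Lemma cone_add K x y : cone K x -> cone K y -> cone K (fun i => x i + y i).
Proof.
move=> + Ky; elim=> [|c s {}x c0 Ks _ IH].
  by apply: cone_ext Ky => i; rewrite add0r.
by apply: cone_ext (ConeD c0 Ks IH) => i; rewrite addrA.
Qed.

Lemma cone_scale K c x : 0 <= c -> cone K x -> cone K (fun i => c * x i).
Proof.
move=> c0; elim=> [|d s {}x d0 Ks _ IH].
  by apply: cone_ext (Cone0 K) => i; rewrite mulr0.
by apply: cone_ext (ConeD (mulr_ge0 c0 d0) Ks IH) => i; rewrite mulrDr mulrA.
Qed.

Lemma cone_mem K s : K s -> cone K s.
Proof.
move=> Ks; apply: cone_ext (ConeD ler01 Ks (Cone0 K)) => i.
by rewrite mul1r addr0.
Qed.

Lemma cone_sum K (I : Type) (r : seq I) (c : I -> R) (s : I -> nat -> R) :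
  (forall j, 0 <= c j) -> (forall j, K (s j)) ->
  cone K (fun i => \sum_(j <- r) c j * s j i).
Proof.
move=> c0 Ks; elim: r => [|j r IH].
  by apply: cone_ext (Cone0 K) => i; rewrite big_nil.
by apply: cone_ext (ConeD (c0 j) (Ks j) IH) => i; rewrite big_cons.
Qed.

Lemma cone_ge0 K ks x : (forall s, K s -> {in ks, forall i, 0 <= s i}) ->
  cone K x -> {in ks, forall i, 0 <= x i}.
Proof.
move=> K0; elim=> [|c s {}x c0 Ks _ IH] i ki //.
by rewrite addr_ge0 ?mulr_ge0 ?IH// K0.
Qed.

(** The double description rule for the half-space [0 <= x k]: the generators inside it stay, and a
    pair on opposite sides gives the positive combination that vanishes at [k]. *)
Definition cut k K : set (nat -> R) :=
  [set s | (K s /\ 0 <= s k) \/ exists p n, [/\ K p, K n, 0 < p k, n k < 0 &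
     s = fun i => p k * n i - n k * p i]].

(* The element [x] is [p + n] with [p] and [n] combinations of the rays on the
   two sides of the hyperplane; when [p k > 0], [x] is a nonnegative combination
   of [p] and of the form [p k * n - n k * p], which is bilinear in [p], [n]. *)
Lemma cone_cut K k x : cone K x -> 0 <= x k -> cone (cut k K) x.
Proof.
move=> Kx xk.
pose Kp : set (nat -> R) := [set s | K s /\ 0 <= s k].
pose Kn : set (nat -> R) := [set s | K s /\ s k < 0].
have KpC p : cone Kp p -> cone (cut k K) p.
  elim=> [|c s y c0 [Ks sk] _ IH]; first exact: Cone0.
  by apply: ConeD => //; left.
have [p [n [Kpp Knn xE]]] : exists p n, [/\ cone Kp p, cone Kn n & x = fun i => p i + n i].
  elim: Kx {xk} => [|c s y c0 Ks _ [p [n [Kpp Knn ->]]]].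
    by exists (fun=> 0), (fun=> 0); split; [exact: Cone0..|apply/funext => i; rewrite addr0].
  have [sk|sk] := leP 0 (s k).
    exists (fun i => c * s i + p i), n; split=> //; first exact: ConeD.
    by apply/funext => i; rewrite addrA.
  exists p, (fun i => c * s i + n i); split=> //; first exact: ConeD.
  by apply/funext => i; rewrite addrCA.
move: xk; rewrite xE {x xE Kx} => xk.
have pk : 0 <= p k by elim: Kpp => [|c s y c0 [_ sk] _ IH]//=; rewrite addr_ge0 ?mulr_ge0.
have nk : n k <= 0.
  elim: Knn => [|c s y c0 [_ sk] _ IH]//=.
  by rewrite -[leRHS]addr0 lerD// mulr_ge0_le0// ltW.
(* Every ray used in [n] is strictly negative at [k], so [n k = 0] forces all coefficients to
   vanish. *)
have nk0 : n k = 0 -> n =1 fun=> 0.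
  elim: Knn {nk} => [//|c s y c0 [_ sk] Kny IH] /= e.
  have yk : y k <= 0.
    elim: Kny {IH e} => [|d t z d0 [_ tk] _ IH]//=.
    by rewrite -[leRHS]addr0 lerD// mulr_ge0_le0// ltW.
  have csk : c * s k <= 0 by rewrite mulr_ge0_le0// ltW.
  have y0 : y k = 0 by apply/eqP; rewrite eq_le yk -e -subr_le0 addrK.
  have /eqP : c * s k = 0 by rewrite -e y0 addr0.
  rewrite mulf_eq0 (lt_eqF sk) orbF => /eqP -> i.
  by rewrite mul0r add0r IH.
have bil : cone (cut k K) (fun i => p k * n i - n k * p i).
  elim: Kpp {pk nk nk0} => [|c s y c0 [Ks sk] Kpy IH].
    by apply: cone_ext (Cone0 _) => i; rewrite mul0r mulr0 subrr.
  have Bs : cone (cut k K) (fun i => s k * n i - n k * s i).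
    elim: Knn {IH} => [|d t z d0 [Kt tk] _ IH].
      by apply: cone_ext (Cone0 _) => i; rewrite mul0r mulr0 subrr.
    have Bt : cone (cut k K) (fun i => s k * t i - t k * s i).
      move: sk; rewrite le_eqVlt => /predU1P[sk|sk].
        have tk' : 0 <= - t k by rewrite oppr_ge0 ltW.
        have Cs : cone (cut k K) s by apply: cone_mem; left; rewrite -sk.
        apply: cone_ext (cone_scale tk' Cs) => i.
        by rewrite -sk mul0r add0r mulNr.
      by apply: cone_mem; right; exists s, t; split.
    apply: cone_ext (cone_add (cone_scale d0 Bt) IH) => i; ring.
  apply: cone_ext (cone_add (cone_scale c0 Bs) IH) => i; ring.
move: pk; rewrite le_eqVlt => /predU1P[pk|pk].
  have n0 : n k = 0 by apply/eqP; rewrite eq_le nk; move: xk; rewrite -pk add0r.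
  by apply: cone_ext (KpC _ Kpp) => i; rewrite nk0// addr0.
have c1 : 0 <= (p k)^-1 by rewrite invr_ge0 ltW.
have c2 : 0 <= 1 + n k / p k by rewrite -(ler_pM2r pk) mul0r mulrDl mul1r divfK ?gt_eqF.
apply: cone_ext (cone_add (cone_scale c1 bil) (cone_scale c2 (KpC _ Kpp))) => i.
by field; rewrite gt_eqF.
Qed.

(** For vectors nonnegative on [ks], this places [s] in the smallest face that contains [x]. *)
Definition covers ks (x s : nat -> R) : Prop := {in ks, forall i, x i = 0 -> s i = 0}.

(** A sum of nonnegative terms vanishes only where each term does, so any ray with positive
    coefficient will serve; [x] being nonzero, there is one. *)
Lemma cone_covered K ks x : (forall s, K s -> {in ks, forall i, 0 <= s i}) ->
  cone K x -> x <> (fun=> 0) -> exists2 s, K s & covers ks x s.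
Proof.
move=> K0; elim=> [//|c s {}x c0 Ks Kx IH].
move: c0; rewrite le_eqVlt => /predU1P[<-|c0].
  rewrite (_ : (fun i => _) = x); last by apply/funext => i; rewrite mul0r add0r.
  exact: IH.
move=> _; exists s => // i ki /eqP.
rewrite paddr_eq0 ?mulr_ge0 ?(ltW c0) ?(K0 s)//; last exact: (cone_ge0 K0 Kx ki).
by rewrite mulf_eq0 gt_eqF//= => /andP[/eqP].
Qed.

(** Each ray used in [x] with positive coefficient vanishes wherever [v] does, hence is [v]
    itself. *)
Lemma cone_ray K ks x v : (forall s, K s -> {in ks, forall i, 0 <= s i}) ->
  (forall s, K s -> covers ks v s -> s = v) ->
  cone K x -> covers ks v x -> exists c, x = fun i => c * v i.
Proof.
move=> K0 Kv; elim=> [_|c s {}x c0 Ks Kx IH vx].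
  by exists 0; apply/funext => i; rewrite mul0r.
have vcs i : i \in ks -> v i = 0 -> c * s i = 0 /\ x i = 0.
  move=> ki vi; have /eqP := vx _ ki vi.
  rewrite paddr_eq0 ?mulr_ge0 ?(K0 s)//; last exact: (cone_ge0 K0 Kx ki).
  by move=> /andP[/eqP -> /eqP ->].
have [d ->] := IH (fun i ki vi => (vcs i ki vi).2).
have [->|cn0] := eqVneq c 0.
  by exists d; apply/funext => i; rewrite mul0r add0r.
exists (c + d); apply/funext => i; rewrite mulrDl (Kv s)// => j kj vj.
by have [/eqP] := vcs j kj vj; rewrite mulf_eq0 (negPf cn0)/= => /eqP.
Qed.

(** The ratio test: the minimal ratio is the largest multiple of [s] that can be subtracted from [x]
    without making a coordinate with [0 < s j] negative. *)
Lemma min_ratio ks x s : (exists2 i, i \in ks & 0 < s i) ->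
  exists i, [/\ i \in ks, 0 < s i &
    {in ks, forall j, 0 < s j -> x i / s i <= x j / s j}].
Proof.
elim: ks => [[]//|k ks IH] h.
have [/IH[i [ki si im]]|nex] := pselect (exists2 i, i \in ks & 0 < s i); last first.
  exists k; have sk : 0 < s k.
    case: h => i; rewrite inE => /predU1P[->//|ki] si.
    by case: nex; exists i.
  split=> //; first exact: mem_head.
  move=> j; rewrite inE => /predU1P[->//|kj] sj.
  by case: nex; exists j.
have [[sk xk]|nk] := pselect (0 < s k /\ x k / s k <= x i / s i).
  exists k; split=> //; first exact: mem_head.
  move=> j; rewrite inE => /predU1P[->//|kj] sj.
  exact: le_trans xk (im _ kj sj).
exists i; split=> //; first by rewrite inE ki orbT.
move=> j; rewrite inE => /predU1P[->|/im//] sk.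
by rewrite leNgt; apply/negP => /ltW h'; apply: nk.
Qed.

Lemma count_lt (T : eqType) (a b : pred T) (l : seq T) :
  {in l, subpred a b} -> (exists2 i, i \in l & b i && ~~ a i) ->
  (count a l < count b l)%N.
Proof.
move=> ab [i li /andP[bi ai]].
have -> : count a l = count (predI a b) l.
  by apply: eq_in_count => j lj /=; case: (boolP (a j)) => // /(ab _ lj) ->.
rewrite -(count_filter a b) -(size_filter b) ltn_neqAle count_size andbT -all_count.
by apply/allPn; exists i => //; rewrite mem_filter bi.
Qed.

(* Induction on the number of nonzero coordinates of [x]: subtract from [x] the
   largest multiple of a covering ray that keeps the coordinates nonnegative. *)
Lemma cone_prune (W : set (nat -> R)) K K' ks :
  (forall x s c, W x -> W s -> W (fun i => x i - c * s i)) ->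
  (forall x, W x -> {in ks, forall i, 0 <= x i} -> cone K x) ->
  (forall s, K s -> {in ks, forall i, 0 <= s i}) ->
  (forall s, K' s -> [/\ W s, {in ks, forall i, 0 <= s i} &
     exists2 i, i \in ks & 0 < s i]) ->
  (forall s, K s -> exists2 t, K' t & covers ks s t) ->
  forall x, W x -> {in ks, forall i, 0 <= x i} -> cone K' x.
Proof.
move=> WB WK K0 K'0 KK' x.
have [m] := ubnP (count (fun i => x i != 0) ks).
elim: m x => // m IH x; rewrite ltnS => xm Wx x0.
have [->|xn0] := pselect (x = fun=> 0); first exact: Cone0.
have [s Ks xs] := cone_covered K0 (WK _ Wx x0) xn0.
have [t Kt st] := KK' _ Ks.
have [Wt t0 tp] := K'0 _ Kt.
have [i [ki ti tm]] := min_ratio x tp.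
have xt : covers ks x t by move=> j kj xj; apply: st => //; exact: xs.
have c0 : 0 <= x i / t i by rewrite divr_ge0 ?x0 ?t0.
set c := x i / t i in c0 tm.
have Kxt : cone K' (fun j => x j - c * t j).
  apply: IH => //; last 2 first.
  - exact: WB.
  - move=> j kj; rewrite subr_ge0; have := t0 _ kj; rewrite le_eqVlt.
    move=> /predU1P[<-|tj]; first by rewrite mulr0 x0.
    by rewrite -ler_pdivlMr// tm.
  apply: leq_trans xm; apply: count_lt.
    move=> j kj; apply: contraNneq => xj.
    by rewrite xj (xt _ kj xj) mulr0 subr0.
  (* The position of the minimal ratio is a new zero: [x] does not vanish there, since [t] vanishes
     wherever [x] does and [0 < t i]. *)
  exists i => //; have tn0 : t i != 0 by rewrite gt_eqF.
  rewrite /c divfK// subrr eqxx andbT.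
  by apply/eqP => /(xt _ ki) ti0; rewrite ti0 ltxx in ti.
apply: cone_ext (ConeD c0 Kt Kxt) => j; by rewrite addrC subrK.
Qed.

End Cone.

(** * The double description method on integer rays *)

Definition isZ0 (z : Z) : bool := if z is Z0 then true else false.

Definition zero_mask (ks : seq nat) (s : seq Z) : bitseq :=
  [seq isZ0 (nth Z0 s i) | i <- ks].

(* Nested [if]s because [&&] evaluates both of its arguments under [vm_compute]. *)
Fixpoint meet_sub (p n q : bitseq) : bool :=
  match p, n, q with
  | a :: p', b :: n', c :: q' =>
      if a then if b then if c then meet_sub p' n' q' else false
                else meet_sub p' n' q' else meet_sub p' n' q'
  | _, _, _ => true
  end.

Fixpoint covered (p n : bitseq) (M : seq (seq Z * bitseq)) : bool :=
  if M is q :: M' then if meet_sub p n q.2 then true else covered p n M'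
  else false.

(** The shorter list counts as padded with zeros, in accordance with the default value of [nth]. *)
Fixpoint zcomb (a b : Z) (s t : seq Z) : seq Z :=
  if s is x :: s' then
    if t is y :: t' then Z.add (Z.mul a x) (Z.mul b y) :: zcomb a b s' t'
    else [seq Z.mul a x | x <- s]
  else [seq Z.mul b y | y <- t].

(** Dividing by the gcd keeps the same ray and prevents the entries from growing from step to
    step. *)
Definition primitive (s : seq Z) : seq Z :=
  let g := foldr Z.gcd Z0 s in [seq Z.div z g | z <- s].

(** With equal first arguments [meet_sub] is plain inclusion of zero sets: rays of [M] whose zeros
    are all zeros of the new ray are dropped in its favour. *)
Definition add_ray ks k M (pn : (seq Z * bitseq) * (seq Z * bitseq)) :=
  let: (p, n) := pn in
  if covered p.2 n.2 M then M else
  let s := primitive (zcomb (nth Z0 p.1 k) (Z.opp (nth Z0 n.1 k)) n.1 p.1) in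
  let m := zero_mask ks s in
  rcons [seq q <- M | ~~ meet_sub q.2 q.2 m] (s, m).

(* Rays with many zeros come first in [M]: they cover most of the pairs. *)
Definition dd_step ks k (K : seq (seq Z)) : seq (seq Z) :=
  let masked := [seq (s, zero_mask ks s) | s <- K] in
  let P := [seq q <- masked | Z.ltb Z0 (nth Z0 q.1 k)] in
  let N := [seq q <- masked | Z.ltb (nth Z0 q.1 k) Z0] in
  let Q := [seq q <- masked | isZ0 (nth Z0 q.1 k)] in
  let M := foldl (add_ray ks k)
    (sort (fun q q' => count id q'.2 <= count id q.2)%N Q)
    [seq (p, n) | n <- N, p <- P] in
  [seq q.1 | q <- P] ++ [seq q.1 | q <- M].

Fixpoint dd ks rest K : seq (seq Z) :=
  if rest is k :: rest' then dd (k :: ks) rest' (dd_step ks k K) else K.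

(* [3 e_{i+1} = sum_a (basis_coef i a) e_{2a+1}], see [effect_basis]. *)
Definition basis_coef (i a : nat) : Z :=
  nth Z0 (nth [::] [:: [:: 3; 0; 0]; [:: 2; 2; -1]; [:: 0; 3; 0];
                       [:: -1; 2; 2]; [:: 0; 0; 3]; [:: 2; -1; 2]]%ZZ i) a.

(* The outcome of effects [e_{i+1}] and [e_{j+1}] sits at position [6 i + j]; the
   positions [12 a + 2 b] are those of the basis effects. *)
Definition table (f : nat -> nat -> Z) : seq Z :=
  [seq f i j | i <- iota 0 6, j <- iota 0 6].

Definition basis_positions : seq nat := [:: 0; 2; 4; 12; 14; 16; 24; 26; 28]%N.

(** Nine times the dual basis: the ray of [(a, b)] is 9 at position [12 a + 2 b] and 0 at the other
    basis positions, so these rays span the initial simplicial cone. *)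
Definition basis_rays : seq (seq Z) :=
  [seq table (fun i j => Z.mul (basis_coef i a) (basis_coef j b)) | a <- iota 0 3, b <- iota 0 3].

(* The order matters only for the lengths of the intermediate lists of rays. *)
Definition other_positions : seq nat :=
  [:: 5; 1; 3; 17; 13; 15; 29; 25; 27; 30; 35; 31; 34; 32; 33;
      18; 23; 19; 22; 20; 21; 6; 11; 7; 10; 8; 9]%N.

Definition rays := dd basis_positions other_positions basis_rays.

(** * Integer rays as vectors over an ordered field *)

Section ZtoR.
Variable R : realFieldType.
Implicit Types (ks : seq nat) (s t : seq Z).

Definition of_Z (z : Z) : R := (int_of_Z z)%:~R.
Local Notation zr := of_Z.

Lemma of_Z0 : zr Z0 = 0. Proof. by []. Qed.

Lemma of_ZD a b : zr (Z.add a b) = zr a + zr b.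
Proof. by rewrite /zr (rmorphD int_of_Z a b) intrD. Qed.

Lemma of_ZM a b : zr (Z.mul a b) = zr a * zr b.
Proof. by rewrite /zr (rmorphM int_of_Z a b) intrM. Qed.

Lemma of_ZN a : zr (Z.opp a) = - zr a.
Proof. by rewrite /zr (rmorphN int_of_Z a) mulrNz. Qed.

Lemma of_Z_ge0 a : (0 <= zr a) = Z.leb Z0 a.
Proof. by rewrite /zr ler0z; case: a => //= p; lia. Qed.

Lemma of_Z_gt0 a : (0 < zr a) = Z.ltb Z0 a.
Proof. by rewrite /zr ltr0z; case: a => //= p; lia. Qed.

Lemma of_Z_lt0 a : (zr a < 0) = Z.ltb a Z0.
Proof. by rewrite /zr ltrz0; case: a => //= p; lia. Qed.

Lemma of_Z_eq0 a : (zr a == 0) = isZ0 a.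
Proof. by rewrite /zr intr_eq0; case: a => //= p; lia. Qed.

Definition ray_vec s : nat -> R := fun i => zr (nth Z0 s i).
Local Notation vec := ray_vec.

Lemma ray_vecE s i : vec s i = zr (nth Z0 s i). Proof. by []. Qed.

Lemma ray_vec_zcomb a b s t :
  vec (zcomb a b s t) = fun i => zr a * vec s i + zr b * vec t i.
Proof.
apply/funext => i; rewrite /vec.
elim: s t i => [|x s IH] [|y t] [|i]; rewrite ?nth_nil ?of_Z0 ?mulr0 ?addr0 ?add0r//.
- by rewrite /= of_ZM.
- rewrite -[zcomb _ _ _ _]/[seq Z.mul b z | z <- y :: t].
  elim: (y :: t) i.+1 => [|z l IHl] [|j]; rewrite ?nth_nil ?of_Z0 ?mulr0//.
  + exact: of_ZM.
  + exact: IHl.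
- by rewrite /= of_ZM.
- rewrite -[zcomb _ _ _ _]/[seq Z.mul a z | z <- x :: s].
  elim: (x :: s) i.+1 {IH} => [|z l IHl] [|j]; rewrite ?nth_nil ?of_Z0 ?mulr0//.
  + exact: of_ZM.
  + exact: IHl.
- by rewrite /= of_ZD !of_ZM.
- exact: IH.
Qed.

Lemma ray_vec_primitive s : exists2 g : R,
  0 <= g & vec s = fun i => g * vec (primitive s) i.
Proof.
pose g := foldr Z.gcd Z0 s.
have g0 : Z.le Z0 g by rewrite /g; case: (s) => [|x l] //=; exact: Z.gcd_nonneg.
exists (zr g); first by rewrite of_Z_ge0; apply/Z.leb_le.
apply/funext => i; rewrite /vec /primitive.
have gs : Z.divide g (nth Z0 s i).
  rewrite /g; clear g g0; elim: s i => [|x s IH] [|i] /=; try exact: Z.divide_0_r.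
    exact: Z.gcd_divide_l.
  exact: Z.divide_trans (Z.gcd_divide_r _ _) (IH i).
have -> : nth Z0 [seq Z.div z g | z <- s] i = Z.div (nth Z0 s i) g.
  have [si|si] := ltnP i (size s); first by rewrite (nth_map Z0).
  by rewrite !nth_default ?size_map.
(* A zero gcd occurs only when all entries are zero, and then both sides vanish. *)
have [g0'|/eqP gn0] := eqVneq g Z0.
  by case: gs => z ->; rewrite g0' Z.mul_0_r of_Z0 mul0r.
by rewrite -of_ZM -Znumtheory.Zdivide_Zdiv_eq //; lia.
Qed.

Lemma meet_subP ks s t u :
  reflect {in ks, forall i, vec s i = 0 -> vec t i = 0 -> vec u i = 0}
          (meet_sub (zero_mask ks s) (zero_mask ks t) (zero_mask ks u)).
Proof.
elim: ks => [|k ks IH] /=; first by constructor.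
rewrite -!of_Z_eq0 -/(vec s k) -/(vec t k) -/(vec u k).
have C : (vec s k = 0 -> vec t k = 0 -> vec u k = 0) ->
  reflect {in k :: ks, forall i, vec s i = 0 -> vec t i = 0 -> vec u i = 0}
   (meet_sub (zero_mask ks s) (zero_mask ks t) (zero_mask ks u)).
  move=> h; apply: (iffP IH) => stu i.
    by rewrite inE => /predU1P[->//|/stu].
  by move=> ki; apply: stu; rewrite inE ki orbT.
case: eqP => sk; last by apply: C.
case: eqP => tk; last by apply: C.
case: eqP => uk; first by apply: C.
by constructor => /(_ k (mem_head _ _) sk tk).
Qed.

End ZtoR.

(** * Correctness of the double description method inside a linear subspace *)

Section DD.
Variables (R : realFieldType) (W : set (nat -> R)).
Hypothesis Wlin : forall x y a b, W x -> W y -> W (fun i => a * x i + b * y i).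
Implicit Types (ks : seq nat) (s t p n : seq Z) (K : seq (seq Z)).
Local Notation vec := (ray_vec R).

Definition vecs K : set (nat -> R) := [set v | exists2 s, s \in K & v = vec s].

(** The last clause excludes a ray vanishing on all of [ks], which would cover every other ray. *)
Definition feasible ks s : Prop :=
  [/\ W (vec s), {in ks, forall i, 0 <= vec s i} &
    exists2 i, i \in ks & 0 < vec s i].

(** A double description pair: inequalities at the positions [ks] inside [W] on one side, generating
    rays on the other. *)
Definition generates ks K : Prop :=
  (forall x, W x -> {in ks, forall i, 0 <= x i} -> cone (vecs K) x) /\
  {in K, forall s, feasible ks s}.

Definition masked ks k (M : seq (seq Z * bitseq)) : Prop :=
  {in M, forall q, [/\ q.2 = zero_mask ks q.1, feasible ks q.1 & vec q.1 k = 0]}.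

(** The invariant of the loop over pairs: single rays of [M] get replaced, but the existence of a
    ray with prescribed zeros persists. *)
Definition hits ks (M : seq (seq Z * bitseq)) (b : nat -> Prop) : Prop :=
  exists2 q, q \in M & {in ks, forall i, b i -> vec q.1 i = 0}.

Lemma coveredP ks k M p n : masked ks k M ->
  covered (zero_mask ks p) (zero_mask ks n) M ->
  hits ks M (fun i => vec p i = 0 /\ vec n i = 0).
Proof.
elim: M => //= q M IH mM.
have mM' : masked ks k M by move=> r rM; apply: mM; rewrite inE rM orbT.
have [-> _ _] := mM q (mem_head _ _).
case: (meet_subP R) => [qs _|_ /(IH mM')[r rM rE]].
  by exists q; [exact: mem_head|move=> i ki [pi ni]; exact: qs].
by exists r => //; rewrite inE rM orbT.
Qed.

(** Both coefficients are positive and both rays are nonnegative on [ks], so an entry vanishes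
    exactly when it does in both rays; at [k] the two terms cancel. *)
Lemma feasible_zcomb ks k p n : feasible ks p -> feasible ks n ->
  0 < vec p k -> vec n k < 0 ->
  let s := primitive (zcomb (nth Z0 p k) (Z.opp (nth Z0 n k)) n p) in
  [/\ feasible ks s, vec s k = 0 &
    {in ks, forall i, vec s i = 0 <-> vec p i = 0 /\ vec n i = 0}].
Proof.
move=> [Wp p0 [j kj pj]] [Wn n0 _] pk nk /=.
set c := zcomb _ _ _ _.
have cE i : vec c i = vec p k * vec n i - vec n k * vec p i.
  by rewrite ray_vec_zcomb of_ZN mulNr.
have Wc : W (vec c) by rewrite ray_vec_zcomb; exact: Wlin.
have pnk : 0 < - vec n k by rewrite oppr_gt0.
have c0 i : i \in ks -> 0 <= vec c i.
  by move=> ki; rewrite cE -mulNr addr_ge0// mulr_ge0 ?(p0 i) ?(n0 i) ?(ltW pk) ?(ltW pnk).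
have cj : 0 < vec c j.
  by rewrite cE -mulNr ltr_wpDl ?mulr_gt0// mulr_ge0 ?(n0 j) ?(ltW pk).
have [g g0 gE] := ray_vec_primitive R c.
have gp : 0 < g^-1.
  rewrite invr_gt0 lt0r g0 andbT; apply/eqP => g00.
  by move: cj; rewrite gE g00 mul0r ltxx.
have sE : vec (primitive c) = fun i => g^-1 * vec c i.
  by apply/funext => i; rewrite gE mulKf// -invr_eq0 gt_eqF.
rewrite sE; split.
- split; rewrite ?sE.
  + rewrite (_ : (fun i => _) = fun i => g^-1 * vec c i + 0 * vec c i); first exact: Wlin.
    by apply/funext => i; rewrite mul0r addr0.
  + by move=> i ki; rewrite mulr_ge0 ?c0// ltW.
  + by exists j => //; rewrite mulr_gt0.
- by rewrite cE [vec n k * _]mulrC subrr mulr0.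
- move=> i ki; have -> : g^-1 * vec c i = 0 <-> vec c i = 0.
    by split=> [/eqP|->]; rewrite ?mulr0// mulf_eq0 gt_eqF//= => /eqP.
  rewrite cE -mulNr; split=> [/eqP|[-> ->]]; last by rewrite !mulr0 addr0.
  rewrite paddr_eq0 ?mulr_ge0 ?(p0 i) ?(n0 i) ?(ltW pk) ?(ltW pnk)//.
  rewrite !mulf_eq0 (gt_eqF pk) (gt_eqF pnk)/=.
  by move=> /andP[/eqP -> /eqP ->].
Qed.

Lemma add_rayP ks k M p n : masked ks k M -> feasible ks p -> feasible ks n ->
  0 < vec p k -> vec n k < 0 ->
  let M' := add_ray ks k M ((p, zero_mask ks p), (n, zero_mask ks n)) in
  [/\ masked ks k M', forall b, hits ks M b -> hits ks M' b &
    hits ks M' (fun i => vec p i = 0 /\ vec n i = 0)].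
Proof.
move=> mM fp fn pk nk /=.
case: ifP => [/(coveredP mM)//|_].
have /= [] := feasible_zcomb fp fn pk nk.
set s := primitive _ => fs sk s0.
split.
- move=> q; rewrite mem_rcons inE => /predU1P[->//|].
  by rewrite mem_filter => /andP[_ /mM].
(* If [q] has been dropped, the new ray vanishes at all zeros of [q] and takes over its role. *)
- move=> b [q qM qb].
  have [qE _ _] := mM q qM.
  have [|nqs] := boolP (meet_sub q.2 q.2 (zero_mask ks s)).
    rewrite qE => /(@meet_subP R _ _ _ _) qs.
    exists (s, zero_mask ks s); first by rewrite mem_rcons mem_head.
    by move=> i ki bi; apply: qs; rewrite ?qb.
  by exists q => //; rewrite mem_rcons inE mem_filter nqs qM orbT.
- exists (s, zero_mask ks s); first by rewrite mem_rcons mem_head.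
  by move=> i ki /(s0 _ ki).
Qed.

Lemma foldl_add_rayP ks k M (L : seq ((seq Z * bitseq) * (seq Z * bitseq))) :
  masked ks k M ->
  {in L, forall pn, exists p n, [/\ pn = ((p, zero_mask ks p), (n, zero_mask ks n)),
     feasible ks p, feasible ks n, 0 < vec p k & vec n k < 0]} ->
  let M' := foldl (add_ray ks k) M L in
  [/\ masked ks k M', forall b, hits ks M b -> hits ks M' b &
    {in L, forall pn, hits ks M' (fun i => vec pn.1.1 i = 0 /\ vec pn.2.1 i = 0)}].
Proof.
elim: L M => [|pn L IH] M mM HL //=.
have [p [n [-> fp fn pk nk]]] := HL _ (mem_head _ _).
have [mM' MM' M'pn] := add_rayP mM fp fn pk nk.
have HL' : {in L, forall pn, exists p n, [/\ pn = ((p, zero_mask ks p), (n, zero_mask ks n)),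
     feasible ks p, feasible ks n, 0 < vec p k & vec n k < 0]}.
  by move=> q qL; apply: HL; rewrite inE qL orbT.
have [mN N1 N2] := IH _ mM' HL'.
split=> //; first by move=> b /MM' /N1.
move=> q; rewrite inE => /predU1P[->|/N2//]; exact: N1.
Qed.

(** [cone_cut] gives generators of the new cone and [cone_prune] exchanges them for the computed
    list: rays positive at [k] are kept, while rays on the hyperplane and combinations of pairs are
    covered by rays of [M]. *)
Lemma generates_dd_step ks k K : generates ks K -> generates (k :: ks) (dd_step ks k K).
Proof.
move=> [gK fK]; rewrite /dd_step.
set mK := [seq _ | s <- K].
set P := [seq q <- mK | Z.ltb Z0 (nth Z0 q.1 k)].
set N := [seq q <- mK | Z.ltb (nth Z0 q.1 k) Z0].
set Q := [seq q <- mK | isZ0 (nth Z0 q.1 k)].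
set M := foldl _ _ _.
have PE s : s \in K -> 0 < vec s k -> (s, zero_mask ks s) \in P.
  move=> sK sk; rewrite mem_filter /= -(of_Z_gt0 R) sk/=.
  by apply/mapP; exists s.
have NE s : s \in K -> vec s k < 0 -> (s, zero_mask ks s) \in N.
  move=> sK sk; rewrite mem_filter /= -(of_Z_lt0 R) sk/=.
  by apply/mapP; exists s.
have QE s : s \in K -> vec s k = 0 -> (s, zero_mask ks s) \in Q.
  move=> sK sk; rewrite mem_filter /= -(of_Z_eq0 R) -/(vec s k) sk eqxx/=.
  by apply/mapP; exists s.
have EP q : q \in P -> exists s, [/\ q = (s, zero_mask ks s), s \in K & 0 < vec s k].
  by rewrite mem_filter -(of_Z_gt0 R) => /andP[qk /mapP[s sK qE]]; exists s; rewrite qE in qk *.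
have EN q : q \in N -> exists s, [/\ q = (s, zero_mask ks s), s \in K & vec s k < 0].
  by rewrite mem_filter -(of_Z_lt0 R) => /andP[qk /mapP[s sK qE]]; exists s; rewrite qE in qk *.
have EQ q : q \in Q -> exists s, [/\ q = (s, zero_mask ks s), s \in K & vec s k = 0].
  by rewrite mem_filter -(of_Z_eq0 R) => /andP[/eqP qk /mapP[s sK qE]]; exists s; rewrite qE in qk *.
have [||mM QM NPM] := @foldl_add_rayP ks k
    (sort (fun q q' => count id q'.2 <= count id q.2)%N Q) [seq (u, v) | v <- N, u <- P].
- by move=> q; rewrite mem_sort => /EQ[s [-> sK sk]]; split=> //; exact: fK.
- move=> pn /allpairsP[[n p] [/= /EN[n' [-> nK nk]] /EP[p' [-> pK pk]] ->]].
  by exists p', n'; split=> //; exact: fK.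
rewrite -/M in mM QM NPM.
have good_step : {in [seq q.1 | q <- P] ++ [seq q.1 | q <- M], forall s, feasible (k :: ks) s}.
  move=> s; rewrite mem_cat => /orP[/mapP[q /EP[t [-> tK tk]] ->]|/mapP[q qM ->]] /=.
    have [Wt t0 [j kj tj]] := fK t tK.
    split=> //; last by exists j => //; rewrite inE kj orbT.
    by move=> i; rewrite inE => /predU1P[->|/t0//]; exact: ltW.
  have [_ [Wt t0 [j kj tj]] tk] := mM q qM.
  split=> //; last by exists j => //; rewrite inE kj orbT.
  by move=> i; rewrite inE => /predU1P[->|/t0//]; rewrite tk.
split=> //.
apply: (@cone_prune _ W (cut k (vecs K))).
- move=> x s c Wx Ws; have := Wlin 1 (- c) Wx Ws.
  by congr W; apply/funext => i; rewrite mul1r mulNr.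
- move=> x Wx x0; apply: cone_cut; last by apply: x0; exact: mem_head.
  by apply: gK => // i ki; apply: x0; rewrite inE ki orbT.
- move=> s [[[t tK ->] tk] i|[_ [_ [[p pK ->] [n nK ->] pk nk ->]]] i].
    by rewrite inE => /predU1P[->//|]; have [_ + _] := fK t tK; apply.
  rewrite inE => /predU1P[->|ki]; first by rewrite mulrC subrr.
  have [_ p0 _] := fK p pK; have [_ n0 _] := fK n nK.
  by rewrite -mulNr addr_ge0// mulr_ge0 ?(p0 i) ?(n0 i) ?oppr_ge0 ?(ltW pk) ?(ltW nk).
- move=> v [s + ->]; exact: good_step.
- move=> s [[[t tK ->]]|].
    rewrite le_eqVlt => /predU1P[/esym tk|tk].
      have [|q qM qt] := QM (fun i => vec t i = 0).
        by exists (t, zero_mask ks t); rewrite ?mem_sort ?QE.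
      exists (vec q.1); first by exists q.1 => //; rewrite mem_cat [X in _ || X]map_f ?orbT.
      move=> i; rewrite inE => /predU1P[->|ki]; last exact: qt.
      by have [_ _ ->] := mM q qM.
    exists (vec t) => //; exists t => //; rewrite mem_cat; apply/orP; left.
    by apply/mapP; exists (t, zero_mask ks t) => //; exact: PE.
  move=> [_ [_ [[p pK ->] [n nK ->] pk nk ->]]].
  have [|q qM qpn] := NPM ((p, zero_mask ks p), (n, zero_mask ks n)).
    apply/allpairsP; exists ((n, zero_mask ks n), (p, zero_mask ks p)).
    by split=> //=; [exact: NE|exact: PE].
  exists (vec q.1); first by exists q.1 => //; rewrite mem_cat [X in _ || X]map_f ?orbT.
  have [_ p0 _] := fK p pK; have [_ n0 _] := fK n nK.
  move=> i; rewrite inE => /predU1P[->|ki]; first by have [_ _ ->] := mM q qM.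
  rewrite -mulNr => /eqP.
  rewrite paddr_eq0 ?mulr_ge0 ?(p0 i) ?(n0 i) ?oppr_ge0 ?(ltW pk) ?(ltW nk)//.
  rewrite !mulf_eq0 oppr_eq0 (gt_eqF pk) (lt_eqF nk)/= => /andP[/eqP n0i /eqP p0i].
  exact: qpn.
Qed.

Lemma generates_dd ks rest K :
  generates ks K -> generates (rev rest ++ ks) (dd ks rest K).
Proof.
elim: rest ks K => [|k rest IH] ks K gK //=.
by rewrite rev_cons cat_rcons; apply: IH; exact: generates_dd_step.
Qed.

End DD.

(** * Effects and transformations of the hexagon *)

(* The permutations of the effects [e_{i+1}] induced by the transposes of [T_k^1] for
   [effect_perm (k, true)] and of [T_k^(-1)] for [effect_perm (k, false)]. *)
Definition effect_perm (g : nat * bool) (i : nat) : nat :=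
  (if g.2 then (i + 6 - g.1) %% 6 else (g.1 + 5 - i) %% 6)%N.

Section Trig.
Variable R : realType.
Local Notation r := (r6 R).
Local Notation q := (Num.sqrt (3 : R)).

(* The angle of [e_{i+1}]. *)
Definition effect_angle (i : nat) : R := (2 * i.+1%:R - 1) * pi / 6.

(** Since [pi / 6] and [pi / 3] are complementary, the sine [s] satisfies [s = 1 - 2 s^2], whose
    only positive root is 1/2. *)
Lemma sin_pi6 : sin (pi / 6) = 1 / 2 :> R.
Proof.
have s0 : 0 < sin (pi / 6) :> R.
  by apply: sin_gt0_pi; have := pi_gt0 R; lra.
have e : sin (pi / 6) = 1 - 2 * sin (pi / 6) ^+ 2 :> R.
  rewrite -{1}cosBpihalf (_ : pi / 6 - pi / 2 = - (pi / 6 + pi / 6)); last by field.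
  rewrite cosN cosD -!expr2 cos2sin2; ring.
have /eqP : (2 * sin (pi / 6) - 1) * (sin (pi / 6) + 1) = 0 :> R by nra.
rewrite mulf_eq0 => /orP[/eqP|/eqP]; lra.
Qed.

Lemma sqr_sqrt3 : q * q = 3. Proof. by rewrite -expr2 sqr_sqrtr. Qed.

Lemma sqrt3_gt0 : 0 < q. Proof. by rewrite sqrtr_gt0. Qed.

Lemma cos_pi6 : cos (pi / 6) = q / 2.
Proof.
have c0 : 0 < cos (pi / 6) :> R.
  by apply: cos_gt0_pihalf; have := pi_gt0 R; lra.
have := cos2Dsin2 (pi / 6 : R); rewrite sin_pi6 => h.
have q0 := sqrt3_gt0; have q2 := sqr_sqrt3.
have /eqP : (cos (pi / 6) - q / 2) * (cos (pi / 6) + q / 2) = 0 by nra.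
by rewrite mulf_eq0 => /orP[/eqP|/eqP]; lra.
Qed.

Lemma sqr_r6 : r ^+ 2 = 2 / q.
Proof. by rewrite sqr_sqrtr cos_pi6 ?invf_div ?divr_ge0 // sqrtr_ge0. Qed.

Lemma r6_neq0 : r != 0.
Proof. by rewrite -sqrf_eq0 sqr_r6 mulf_neq0 ?invr_eq0 ?gt_eqF ?sqrt3_gt0. Qed.

Lemma sqr_r6_sqrt3 : r ^+ 2 * q = 2.
Proof. by rewrite sqr_r6 divfK ?gt_eqF ?sqrt3_gt0. Qed.

Lemma cos_effect_angle i : (i < 6)%N -> cos (effect_angle i) =
  nth 0 [:: q / 2; 0; - (q / 2); - (q / 2); 0; q / 2] i.
Proof.
rewrite /effect_angle.
move: i => [|[|[|[|[|[|//]]]]]] _ /=.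
- by rewrite -cos_pi6; congr cos; field.
- by rewrite -[RHS]cos_pihalf; congr cos; field.
- by rewrite -cos_pi6 -[cos (pi / 6)]cosN -cosDpi; congr cos; field.
- by rewrite -cos_pi6 -cosDpi; congr cos; field.
- by rewrite -[RHS]oppr0 -cos_pihalf -cosDpi; congr cos; field.
- by rewrite -cos_pi6 -[cos (pi / 6)]cosN -[cos (- _)]cosD2pi mulr2n; congr cos; field.
Qed.

Lemma sin_effect_angle i : (i < 6)%N -> sin (effect_angle i) =
  nth 0 [:: 1 / 2; 1; 1 / 2; - (1 / 2); - 1; - (1 / 2)] i.
Proof.
rewrite /effect_angle.
move: i => [|[|[|[|[|[|//]]]]]] _ /=.
- by rewrite -sin_pi6; congr sin; field.
- by rewrite -[RHS]sin_pihalf; congr sin; field.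
- by rewrite -sin_pi6 -[RHS]opprK -sinN -sinDpi; congr sin; field.
- by rewrite -sin_pi6 -sinDpi; congr sin; field.
- by rewrite -[in RHS]sin_pihalf -sinDpi; congr sin; field.
- by rewrite -sin_pi6 -sinN -[sin (- _)]sinD2pi mulr2n; congr sin; field.
Qed.

Lemma effect_angle_mod i : exists m : nat, effect_angle i = effect_angle (i %% 6) + pi *+ 2 *+ m.
Proof.
exists (i %/ 6)%N; rewrite /effect_angle {1}(divn_eq i 6) -addnS natrD natrM.
by rewrite -[pi *+ 2 *+ _]mulr_natr mulr2n -natr1; field.
Qed.

(** Modulo 6 the indices are [i - k] for the rotation and [k - 1 - i] for the reflection; a full
    turn is added so that the subtraction of naturals does not truncate. *)
Lemma effect_angle_perm i k : (i < 6)%N -> (k <= 6)%N ->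
  [/\ cos (effect_angle i - 2 * pi * k%:R / 6) = cos (effect_angle (effect_perm (k, true) i)),
      sin (effect_angle i - 2 * pi * k%:R / 6) = sin (effect_angle (effect_perm (k, true) i)),
      cos (effect_angle i - 2 * pi * k%:R / 6) = cos (effect_angle (effect_perm (k, false) i)) &
      - sin (effect_angle i - 2 * pi * k%:R / 6) = sin (effect_angle (effect_perm (k, false) i))].
Proof.
move=> i6 k6; rewrite /effect_perm /=.
have [m em] := effect_angle_mod (i + 6 - k).
have [n en] := effect_angle_mod (k + 5 - i).
have e1 : effect_angle i - 2 * pi * k%:R / 6 + pi *+ 2 = effect_angle (i + 6 - k).
  rewrite /effect_angle -!natr1 natrB; last lia.
  by rewrite natrD mulr2n; field.
have e2 : - (effect_angle i - 2 * pi * k%:R / 6) + pi *+ 2 = effect_angle (k + 5 - i).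
  rewrite /effect_angle -!natr1 natrB; last lia.
  by rewrite natrD mulr2n; field.
have pC := @periodicn _ _ _ _ (@cosD2pi R).
have pS := @periodicn _ _ _ _ (@sinD2pi R).
split.
- by rewrite -(cosD2pi (_ - _)) e1 em pC.
- by rewrite -(sinD2pi (_ - _)) e1 em pS.
- by rewrite -cosN -(cosD2pi (- _)) e2 en pC.
- by rewrite -sinN -(sinD2pi (- _)) e2 en pS.
Qed.

End Trig.

(** * Tables of outcomes *)

Section Outcomes.
Variable R : realType.
Local Notation r := (r6 R).
Local Notation q := (Num.sqrt (3 : R)).
Local Notation zr := (of_Z R).
Local Notation vec := (ray_vec R).
Implicit Types (Phi Psi T : 'M[R]_3) (e f : 'cV[R]_3).

Lemma outcomeZl a e Phi f : outcome (a *: e) Phi f = a * outcome e Phi f.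
Proof. by rewrite /outcome linearZ/= -!scalemxAl mxE. Qed.

Lemma outcomeZr a e Phi f : outcome e Phi (a *: f) = a * outcome e Phi f.
Proof. by rewrite /outcome -scalemxAr mxE. Qed.

Lemma outcome_suml (I : finType) (e : I -> 'cV[R]_3) Phi f :
  outcome (\sum_a e a) Phi f = \sum_a outcome (e a) Phi f.
Proof. by rewrite /outcome linear_sum/= !mulmx_suml summxE. Qed.

Lemma outcome_sumr (I : finType) e Phi (f : I -> 'cV[R]_3) :
  outcome e Phi (\sum_a f a) = \sum_a outcome e Phi (f a).
Proof. by rewrite /outcome mulmx_sumr summxE. Qed.

Lemma outcomeDM a b e Phi Psi f :
  outcome e (a *: Phi + b *: Psi) f = a * outcome e Phi f + b * outcome e Psi f.
Proof. by rewrite /outcome mulmxDr mulmxDl -!scalemxAr -!scalemxAl !mxE. Qed.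

Lemma effectE i : effect R i.+1 =
  2^-1 *: col3 [:: r * cos (effect_angle R i); r * sin (effect_angle R i); 1].
Proof. by []. Qed.

Lemma col3P (s t : seq R) : s`_0 = t`_0 -> s`_1 = t`_1 -> s`_2 = t`_2 -> col3 s = col3 t.
Proof.
move=> e0 e1 e2; apply/matrixP => -[[|[|[|//]]] hi] j; rewrite !mxE //=.
Qed.

Lemma col3Z a (s : seq R) : a *: col3 s = col3 [:: a * s`_0; a * s`_1; a * s`_2].
Proof. by apply/matrixP => -[[|[|[|//]]] hi] j; rewrite !mxE. Qed.

Lemma col3D (s t : seq R) :
  col3 s + col3 t = col3 [:: s`_0 + t`_0; s`_1 + t`_1; s`_2 + t`_2].
Proof. by apply/matrixP => -[[|[|[|//]]] hi] j; rewrite !mxE. Qed.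

Lemma effect_basis i : (i < 6)%N ->
  3 *: effect R i.+1 = \sum_(a < 3) zr (basis_coef i a) *: effect R (2 * a).+1.
Proof.
have z3 : zr 3%ZZ = 3 by [].
have z2 : zr 2%ZZ = 2 by [].
have zN1 : zr (-1)%ZZ = - 1 by [].
move=> i6; rewrite !big_ord_recl big_ord0 addr0 !effectE !col3Z !col3D.
rewrite /= !cos_effect_angle// !sin_effect_angle//.
by move: i i6 => [|[|[|[|[|[|//]]]]]] _; apply: col3P => /=; rewrite ?z3 ?z2 ?zN1 ?of_Z0; field.
Qed.

Lemma unit_effect_basis :
  3 *: unit_effect R = \sum_(a < 3) 2 *: effect R (2 * a).+1.
Proof.
rewrite !big_ord_recl big_ord0 addr0 !effectE /unit_effect !col3Z !col3D.
rewrite /= !cos_effect_angle// !sin_effect_angle//.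
by apply: col3P => /=; field.
Qed.

Lemma hex_transformation_effect k (b : bool) i : (i < 6)%N -> (k <= 6)%N ->
  (hex_transformation k ((-1) ^+ (~~ b)))^T *m effect R i.+1 = effect R (effect_perm (k, b) i).+1.
Proof.
move=> i6 k6; rewrite !effectE -scalemxAr; congr (_ *: _).
have [ec es ec' es'] := effect_angle_perm R i6 k6.
rewrite /hex_transformation; set a := 2 * pi * k%:R / 6 in ec es ec' es' *.
have -> : (mx3 [:: [:: cos a; - (-1) ^+ (~~ b) * sin a; 0]; [:: sin a; (-1) ^+ (~~ b) * cos a; 0];
    [:: 0; 0; 1]])^T *m col3 [:: r * cos (effect_angle R i); r * sin (effect_angle R i); 1] =
  col3 [:: r * cos (effect_angle R i - a); (-1) ^+ (~~ b) * (r * sin (effect_angle R i - a)); 1].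
  rewrite cosB sinB; apply/matrixP => -[[|[|[|//]]] hi] j;
  by rewrite !mxE !big_ord_recl big_ord0 !mxE /=; ring.
case: b => /=.
  by rewrite ec es; apply: col3P => /=; rewrite ?mul1r.
by rewrite ec' -es'; apply: col3P => //=; rewrite mulN1r mulrN.
Qed.

(** The value 0 from position 36 on matches the default of [ray_vec], so tables can be compared as
    functions on [nat]. *)
Definition outcomes Phi : nat -> R := fun n =>
  if (n < 36)%N then outcome (effect R (n %/ 6).+1) Phi (effect R (n %% 6).+1) else 0.

Lemma outcomesE Phi i j : (i < 6)%N -> (j < 6)%N ->
  outcomes Phi (6 * i + j) = outcome (effect R i.+1) Phi (effect R j.+1).
Proof.
move=> i6 j6; rewrite /outcomes.
have -> : (6 * i + j < 36)%N by lia.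
have -> : ((6 * i + j) %/ 6 = i)%N by lia.
by have -> : ((6 * i + j) %% 6 = j)%N by lia.
Qed.

Lemma outcomes_default Phi n : (36 <= n)%N -> outcomes Phi n = 0.
Proof. by move=> h; rewrite /outcomes ltnNge h. Qed.

(* The linear relations between the entries of a table that come from [basis_coef]. *)
Definition consistent (x : nat -> R) : Prop :=
  (forall n, (36 <= n)%N -> x n = 0) /\
  forall i j, (i < 6)%N -> (j < 6)%N -> 9 * x (6 * i + j)%N =
    \sum_(a < 3) \sum_(b < 3)
      zr (basis_coef i a) * zr (basis_coef j b) * x (12 * a + 2 * b)%N.

Lemma consistent_lin x y a b : consistent x -> consistent y ->
  consistent (fun i => a * x i + b * y i).
Proof.
move=> [x0 xE] [y0 yE]; split=> [n n36|i j i6 j6]; first by rewrite x0// y0// !mulr0 addr0.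
rewrite mulrDr !(mulrCA 9) xE// yE// !mulr_sumr -big_split/=; apply: eq_bigr => c _.
rewrite !mulr_sumr -big_split/=; apply: eq_bigr => d _; ring.
Qed.

Lemma consistent_eq x y : consistent x -> consistent y ->
  (forall a b, (a < 3)%N -> (b < 3)%N -> x (12 * a + 2 * b)%N = y (12 * a + 2 * b)%N) -> x = y.
Proof.
move=> [x0 xE] [y0 yE] xy; apply/funext => n.
have [n36|n36] := ltnP n 36; last by rewrite x0// y0.
have -> : n = (6 * (n %/ 6) + n %% 6)%N by lia.
have h : (9 : R) != 0 by rewrite pnatr_eq0.
apply: (mulfI h); rewrite xE ?yE; try lia.
by apply: eq_bigr => a _; apply: eq_bigr => b _; rewrite xy.
Qed.

Lemma consistent_outcomes Phi : consistent (outcomes Phi).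
Proof.
split=> [n|i j i6 j6]; first exact: outcomes_default.
have -> : 9 = 3 * 3 :> R by ring.
rewrite outcomesE// -mulrA -outcomeZr -outcomeZl !effect_basis// outcome_suml.
apply: eq_bigr => a _; rewrite outcome_sumr; apply: eq_bigr => b _.
rewrite outcomeZl outcomeZr mulrA -outcomesE; try by have := ltn_ord a; have := ltn_ord b; lia.
by congr (_ * outcomes _ _); lia.
Qed.

(** From [3 u = 2 (e_1 + e_3 + e_5)]: the normalization becomes a linear form on tables, which fixes
    the scale of a state known up to a factor. *)
Lemma outcome_unit Phi : outcome (unit_effect R) Phi (unit_effect R) =
  4 / 9 * \sum_(a < 3) \sum_(b < 3) outcomes Phi (12 * a + 2 * b).
Proof.
have h : (9 : R) != 0 by rewrite pnatr_eq0.
apply: (mulfI h); rewrite mulrA [9 * (4 / 9)]mulrC divfK//.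
have {1}-> : 9 = 3 * 3 :> R by ring.
rewrite -mulrA -outcomeZr -outcomeZl unit_effect_basis outcome_suml mulr_sumr.
apply: eq_bigr => a _; rewrite outcome_sumr mulr_sumr; apply: eq_bigr => b _.
rewrite outcomeZl outcomeZr mulrA -outcomesE; try by have := ltn_ord a; have := ltn_ord b; lia.
rewrite (_ : (6 * (2 * a) + 2 * b = 12 * a + 2 * b)%N); last lia.
by congr (_ * _); ring.
Qed.

Lemma max_tensor_statesP Phi : max_tensor_states Phi <->
  outcome (unit_effect R) Phi (unit_effect R) = 1 /\ {in iota 0 36, forall n, 0 <= outcomes Phi n}.
Proof.
split=> -[h1 h2]; split=> //.
  move=> n; rewrite mem_iota /= add0n => n36; rewrite /outcomes n36.
  by apply: h2; rewrite /hex_index; lia.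
rewrite /hex_index => -[|i] [|j] //= i6 j6; rewrite -outcomesE//.
by apply: h2; rewrite mem_iota; lia.
Qed.

(** The rows of [E] are the basis effects [e_1], [e_3], [e_5] and [F] is its explicit inverse, so
    [A] is recovered from the nine entries of [E A E^T]. *)
Lemma outcomes_inj : injective outcomes.
Proof.
move=> Phi Psi e.
pose E : 'M[R]_3 := \matrix_(i, j) effect R (2 * i).+1 j 0.
pose F : 'M[R]_3 := mx3 [:: [:: r; - r; 0]; [:: 2 / 3 / r; 2 / 3 / r; - (4 / 3 / r)];
  [:: 2 / 3; 2 / 3; 2 / 3]].
have E0 (i j : 'I_3) : E i j = 2^-1 *
    [:: r * cos (effect_angle R (2 * i)); r * sin (effect_angle R (2 * i)); 1]`_j.
  by rewrite mxE effectE !mxE.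
have rq := sqr_r6_sqrt3 R; have rn0 := r6_neq0 R.
have FE : F *m E = 1%:M.
  apply/matrixP => i j; rewrite mxE !big_ord_recl big_ord0 !E0.
  rewrite /= !cos_effect_angle// !sin_effect_angle// /F !mxE.
  by move: i j => [[|[|[|//]]] hi] [[|[|[|//]]] hj]; rewrite /= ?mulr1n ?mulr0n; (lra || field).
have EPE A : E *m A *m E^T = \matrix_(i, j) outcomes A (6 * (2 * i) + 2 * j).
  apply/matrixP => i j.
  rewrite [RHS]mxE outcomesE; try by have := ltn_ord i; have := ltn_ord j; lia.
  rewrite /outcome !mxE; apply: eq_bigr => b _; rewrite !mxE; congr (_ * _).
  by apply: eq_bigr => a _; rewrite !mxE.
have EF A : A = F *m (E *m A *m E^T) *m F^T.
  by rewrite !mulmxA FE mul1mx -mulmxA -trmx_mul FE trmx1 mulmx1.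
by rewrite (EF Phi) (EF Psi) !EPE e.
Qed.

End Outcomes.

(** * Integer tables of the extreme states *)

(* [v i a] is [2 * e_{i+1}^T omega_a]. *)
Definition product_ray (a b : nat) : seq Z :=
  let v i a := nth Z0 [:: 2; 1; 0; 0; 1; 2]%ZZ (effect_perm (a, true) i) in
  table (fun i j => Z.mul (v i a) (v j b)).

(* Outcome tables of the six representatives, cleared of denominators. *)
Definition representative_rays : seq (seq Z) :=
  [:: [:: 2; 1; 0; 0; 1; 2;
          1; 0; 0; 1; 2; 2;
          0; 0; 1; 2; 2; 1;
          0; 1; 2; 2; 1; 0;
          1; 2; 2; 1; 0; 0;
          2; 2; 1; 0; 0; 1];
      [:: 17; 16; 8; 1; 2; 10;
          16; 12; 4; 0; 4; 12;
          8; 4; 0; 0; 4; 8;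
          1; 0; 0; 1; 2; 2;
          2; 4; 4; 2; 0; 0;
          10; 12; 8; 2; 0; 4];
      [:: 14; 12; 5; 0; 2; 9;
          12; 8; 2; 0; 4; 10;
          5; 2; 0; 1; 4; 6;
          0; 0; 1; 2; 2; 1;
          2; 4; 4; 2; 0; 0;
          9; 10; 6; 1; 0; 4];
      [:: 24; 20; 8; 0; 4; 16;
          24; 16; 4; 0; 8; 20;
          13; 6; 0; 1; 8; 14;
          2; 0; 0; 2; 4; 4;
          2; 4; 4; 2; 0; 0;
          13; 14; 8; 1; 0; 6];
      [:: 24; 24; 13; 2; 2; 13;
          20; 16; 6; 0; 4; 14;
          8; 4; 0; 0; 4; 8;
          0; 0; 1; 2; 2; 1;
          4; 8; 8; 4; 0; 0;
          16; 20; 14; 4; 0; 6];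
      [:: 0; 0; 2; 4; 4; 2;
          0; 1; 2; 2; 1; 0;
          2; 2; 1; 0; 0; 1;
          4; 2; 0; 0; 2; 4;
          4; 1; 0; 2; 5; 6;
          2; 0; 1; 4; 6; 5]]%ZZ.

(** The table of [T_g Phi T_h^T]: the transformations move over to the effects as transposes, so the
    table is pulled back along the two permutations. *)
Definition act g h (s : seq Z) : seq Z :=
  table (fun i j => nth Z0 s (6 * effect_perm g i + effect_perm h j)).

Definition hex_syms : seq (nat * bool) := [seq (k, b) | k <- iota 1 6, b <- [:: true; false]].

Definition product_rays := [seq product_ray a b | a <- iota 1 6, b <- iota 1 6].

Definition orbit s := [seq act g h s | g <- hex_syms, h <- hex_syms].

Definition zeros := zero_mask (iota 0 36).

Definition zconsistent (s : seq Z) : bool :=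
  (size s == 36) &&
  all (fun i => all (fun j =>
    Z.eqb (Z.mul 9%ZZ (nth Z0 s (6 * i + j)))
      (foldr Z.add Z0 [seq Z.mul (Z.mul (basis_coef i a) (basis_coef j b))
                                 (nth Z0 s (12 * a + 2 * b)) | a <- iota 0 3, b <- iota 0 3]))
    (iota 0 6)) (iota 0 6).

Definition nonneg_at ks (s : seq Z) := all (fun k => Z.leb Z0 (nth Z0 s k)) ks.

Lemma basis_rays_check : all (fun s => [&& zconsistent s, nonneg_at basis_positions s &
  has (fun k => Z.ltb Z0 (nth Z0 s k)) basis_positions]) basis_rays.
Proof. by vm_compute. Qed.

Lemma representative_rays_check :
  all (fun s => zconsistent s && nonneg_at (iota 0 36) s) representative_rays.
Proof. by vm_compute. Qed.

Definition known_rays := product_rays ++ flatten [seq orbit r | r <- representative_rays].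

(** The first clause bounds the extreme states from above; the second says that no other ray
    vanishes at all zeros of a representative, which yields its extremality. The argument [K] stays
    abstract, so that only [rays_check_rays] evaluates [rays]. *)
Definition rays_check (K : seq (seq Z)) : bool :=
  let L := known_rays in
  all (fun s => s \in L) K &&
  all (fun r => all (fun s => meet_sub (zeros r) (zeros r) (zeros s) ==> (s == r)) K)
    representative_rays.

Lemma rays_checkP K : rays_check K -> {subset K <= known_rays} /\
  {in representative_rays & K, forall r s, meet_sub (zeros r) (zeros r) (zeros s) -> s = r}.
Proof.
move=> /andP[/allP h1 /allP h2]; split=> // r s rr sK h.
by have /allP/(_ s sK)/implyP/(_ h)/eqP := h2 r rr.
Qed.

Lemma rays_check_rays : rays_check rays.
Proof. by vm_compute. Qed.

(** A zero pattern ignores the factor between a table and its integer ray, so distinct patterns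
    already separate states. *)
Lemma product_rays_check :
  all (fun r => zeros r \notin [seq zeros s | s <- product_rays]) representative_rays.
Proof. by vm_compute. Qed.

Lemma product_rays_ge0 : all (nonneg_at (iota 0 36)) product_rays.
Proof. by vm_compute. Qed.

Lemma orbits_check : all (fun i => all (fun j => (i == j) ||
  (zeros (nth [::] representative_rays j)
     \notin [seq zeros s | s <- orbit (nth [::] representative_rays i)])) (iota 0 6)) (iota 0 6).
Proof. by vm_compute. Qed.

(** * From integer rays to states *)

Section Classification.
Variable R : realType.
Local Notation zr := (of_Z R).
Local Notation vec := (ray_vec R).
Local Notation consistent := (@consistent R).
Implicit Types (Phi Psi T : 'M[R]_3).

Lemma of_Z_foldr_add (l : seq Z) : zr (foldr Z.add Z0 l) = \sum_(z <- l) zr z.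
Proof. by elim: l => [|z l IH]; rewrite ?big_nil ?big_cons //= of_ZD IH. Qed.

Lemma ray_vec_default s n : (size s <= n)%N -> vec s n = 0.
Proof. by move=> h; rewrite ray_vecE nth_default. Qed.

Lemma ray_vec_table f i j : (i < 6)%N -> (j < 6)%N -> vec (table f) (6 * i + j) = zr (f i j).
Proof.
by move: i j => [|[|[|[|[|[|//]]]]]] [|[|[|[|[|[|//]]]]]].
Qed.

Lemma table_eq (x y : nat -> R) :
  (forall n, (36 <= n)%N -> x n = 0) -> (forall n, (36 <= n)%N -> y n = 0) ->
  (forall i j, (i < 6)%N -> (j < 6)%N -> x (6 * i + j)%N = y (6 * i + j)%N) -> x = y.
Proof.
move=> x0 y0 xy; apply/funext => n.
have [n36|n36] := ltnP n 36; last by rewrite x0// y0.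
have -> : n = (6 * (n %/ 6) + n %% 6)%N by lia.
by apply: xy; lia.
Qed.

Lemma consistent_vec s : zconsistent s -> consistent (vec s).
Proof.
move=> /andP[/eqP s36 /allP h]; split=> [n n36|i j i6 j6]; first by rewrite ray_vec_default// s36.
have ii : i \in iota 0 6 by rewrite mem_iota.
have jj : j \in iota 0 6 by rewrite mem_iota.
have /allP hi := h i ii; have /Z.eqb_eq e := hi j jj.
have -> : 9 = zr 9%ZZ by [].
rewrite -of_ZM e of_Z_foldr_add /= !big_cons big_nil !of_ZM !big_ord_recl !big_ord0 /=; ring.
Qed.

(** The relations in [consistent] are the expansion of [x] in [basis_rays], with coefficients the
    basis entries of [x] divided by 9. *)
Lemma generates_basis : generates consistent basis_positions basis_rays.
Proof.
have ck := allP basis_rays_check.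
split=> [x [x0 xE] xp|s /ck /and3P[/consistent_vec Ws /allP sp /hasP[k kp sk]]]; last first.
  split=> //; last by exists k; rewrite ?of_Z_gt0.
  by move=> i /sp; rewrite -(of_Z_ge0 R).
pose ray (ab : 'I_3 * 'I_3) : seq Z :=
  table (fun i j => Z.mul (basis_coef i ab.1) (basis_coef j ab.2)).
pose w (ab : 'I_3 * 'I_3) : R := x (12 * ab.1 + 2 * ab.2)%N / 9.
have : cone (@vecs R basis_rays) (fun n => \sum_(ab <- index_enum _) w ab * vec (ray ab) n).
  apply: cone_sum => -[a b].
    rewrite divr_ge0// xp//.
    by move: a b => [[|[|[|//]]] ha] [[|[|[|//]]] hb].
  exists (ray (a, b)) => //; apply/allpairsP; exists (val a, val b).
  by split; rewrite ?mem_iota //= ltn_ord.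
apply: cone_ext => n; have [n36|n36] := ltnP n 36; last first.
  rewrite x0// big1// => ab _; rewrite ray_vec_default ?mulr0//.
have -> : n = (6 * (n %/ 6) + n %% 6)%N by lia.
set i := (n %/ 6)%N; set j := (n %% 6)%N.
have i6 : (i < 6)%N by rewrite /i; lia.
have j6 : (j < 6)%N by rewrite /j; lia.
have h : (9 : R) != 0 by rewrite pnatr_eq0.
apply: (mulfI h); rewrite xE// pair_big mulr_sumr; apply: eq_bigr => -[a b] _ /=.
by rewrite ray_vec_table// of_ZM /w /=; field.
Qed.

Lemma generates_rays : generates consistent (rev other_positions ++ basis_positions) rays.
Proof. apply: generates_dd; [exact: consistent_lin|exact: generates_basis]. Qed.

Lemma all_positions n : n \in iota 0 36 = (n \in rev other_positions ++ basis_positions).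
Proof.
have : perm_eq (iota 0 36) (rev other_positions ++ basis_positions) by vm_compute.
by move/perm_mem.
Qed.

Lemma rays_ge0 v : @vecs R rays v -> {in iota 0 36, forall n, 0 <= v n}.
Proof.
move=> [s sK ->] n; rewrite all_positions.
by have [_ + _] := generates_rays.2 s sK; apply.
Qed.

Lemma state_cone Phi : max_tensor_states Phi -> cone (@vecs R rays) (outcomes Phi).
Proof.
move=> /max_tensor_statesP[_ p]; apply: generates_rays.1; first exact: consistent_outcomes.
by move=> n; rewrite -all_positions; exact: p.
Qed.

Lemma state_covered Phi : max_tensor_states Phi ->
  exists2 s, s \in rays & covers (iota 0 36) (outcomes Phi) (vec s).
Proof.
move=> st; have [|v [s sK ->] h] := cone_covered rays_ge0 (state_cone st); last by exists s.
(* The zero table is impossible: it would give the unit outcome 0 instead of 1. *)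
move=> e; case: st => + _; rewrite outcome_unit big1 ?mulr0.
  by move=> /esym/eqP; rewrite oner_eq0.
by move=> a _; rewrite big1// => b _; rewrite e.
Qed.

(** Only positions with [0 < y n] restrict [c]; there [x n] is positive because zeros of [x] are
    zeros of [y], so [c] can be a minimum of finitely many positive numbers. *)
Lemma small_multiple (ks : seq nat) (x y : nat -> R) :
  {in ks, forall n, 0 <= x n} -> covers ks x y ->
  exists2 c, 0 < c & {in ks, forall n, c * y n <= x n}.
Proof.
elim: ks => [|k ks IH] x0 xy; first by exists 1.
have [|n kn|c c0 h] := IH; first by move=> n kn; apply: x0; rewrite inE kn orbT.
  by apply: xy; rewrite inE kn orbT.
have [yk|yk] := leP (y k) 0.
  exists c => // n; rewrite inE => /predU1P[->|/h//].
  by rewrite (le_trans (mulr_ge0_le0 (ltW c0) yk))// x0// mem_head.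
have xk : 0 < x k.
  rewrite lt0r x0 ?mem_head// andbT; apply/eqP => /(xy _ (mem_head _ _)) e.
  by rewrite e ltxx in yk.
exists (Num.min c (x k / y k)); first by rewrite lt_min c0 divr_gt0.
move=> n; rewrite inE => /predU1P[->|kn]; first by rewrite -ler_pdivlMr// ge_min lexx orbT.
have [yn|yn] := leP 0 (y n).
  by apply: le_trans (h n kn); rewrite ler_wpM2r// ge_min lexx.
apply: le_trans (x0 _ _); last by rewrite inE kn orbT.
by rewrite mulr_ge0_le0 ?(ltW yn)// le_min (ltW c0) divr_ge0 ?(ltW xk) ?(ltW yk).
Qed.

Lemma outcomes_comb a b Phi Psi :
  outcomes (a *: Phi + b *: Psi) = fun n => a * outcomes Phi n + b * outcomes Psi n.
Proof.
by apply/funext => n; rewrite /outcomes; case: ifP => _; rewrite ?outcomeDM// !mulr0 addr0.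
Qed.

Lemma extreme_state_covered Phi Psi : extreme_points (@max_tensor_states R) Phi ->
  max_tensor_states Psi -> covers (iota 0 36) (outcomes Phi) (outcomes Psi) -> Psi = Phi.
Proof.
move=> [st ext] st' cov.
have /max_tensor_statesP[u p] := st; have /max_tensor_statesP[u' p'] := st'.
have [c c0 h] := small_multiple p cov.
have c1 : 1 + c != 0 by rewrite gt_eqF// addr_gt0.
(* [Z] lies beyond [Phi] on the line from [Psi], and [Phi] divides the segment with weight
   [c / (1 + c)] on [Psi]. *)
pose Z := (1 + c) *: Phi + (- c) *: Psi.
have [] // := ext Psi Z (c / (1 + c)) st'.
- apply/max_tensor_statesP; rewrite outcomeDM u u'; split; first by ring.
  move=> n kn; rewrite outcomes_comb mulrDl mul1r mulNr addrAC addr_ge0 ?subr_ge0 ?h//.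
  by rewrite mulr_ge0 ?p// ltW.
- by rewrite divr_gt0 ?addr_gt0//= ltr_pdivrMr ?addr_gt0// mul1r ltrDr.
- have e1 : (1 - c / (1 + c)) * (1 + c) = 1 by field.
  have e2 : c / (1 + c) + (1 - c / (1 + c)) * (- c) = 0 by field.
  by rewrite /Z scalerDr !scalerA e1 scale1r addrCA -scalerDl e2 scale0r addr0.
Qed.

End Classification.

(** * Product states and representatives *)

Section States.
Variable R : realType.
Local Notation r := (r6 R).
Local Notation q := (Num.sqrt (3 : R)).
Local Notation zr := (of_Z R).
Local Notation vec := (ray_vec R).
Local Notation consistent := (@consistent R).
Implicit Types (Phi Psi T : 'M[R]_3).

Local Notation U := (unit_effect R).

Definition sym_transformation (g : nat * bool) : 'M[R]_3 :=
  hex_transformation g.1 ((-1) ^+ (~~ g.2)).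

Lemma mem_hex_syms g : (g \in hex_syms) = hex_index g.1.
Proof.
case: g => k b; rewrite /hex_index /=; apply/allpairsP/idP => [[[k' b']]|k6].
  by case; rewrite mem_iota => k6 _ [-> _].
by exists (k, b); split; rewrite ?mem_iota//; case: b.
Qed.

Lemma reversibleP T : reversible T <-> exists2 g, g \in hex_syms & T = sym_transformation g.
Proof.
split=> [[k [s [k6 s1 ->]]]|[[k b]]]; last first.
  rewrite mem_hex_syms /= => k6 ->; exists k, ((-1) ^+ (~~ b)); split=> //.
  by case: b; [left|right].
by case: s1 => ->; [exists (k, true)|exists (k, false)]; rewrite ?mem_hex_syms.
Qed.

Lemma effect_perm_lt g i : (effect_perm g i < 6)%N.
Proof. by rewrite /effect_perm; case: ifP => _; rewrite ltn_pmod. Qed.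

Lemma sym_transformation_effect g i : g \in hex_syms -> (i < 6)%N ->
  (sym_transformation g)^T *m effect R i.+1 = effect R (effect_perm g i).+1.
Proof.
case: g => k b; rewrite mem_hex_syms /hex_index /= => k6 i6.
by apply: hex_transformation_effect => //; case/andP: k6.
Qed.

Lemma sym_transformation_unit g : (sym_transformation g)^T *m U = U.
Proof.
apply/matrixP => i j; rewrite !mxE !big_ord_recl big_ord0 !mxE /=.
by move: i => [[|[|[|//]]] hi] /=; ring.
Qed.

Lemma outcome_unitE Phi : outcome U Phi U = Phi ord_max ord_max.
Proof.
rewrite /outcome !mxE !big_ord_recl big_ord0 !mxE !big_ord_recl !big_ord0 !mxE /=.
rewrite !(mul0r, mulr0, add0r, addr0, mul1r, mulr1); congr (Phi _ _); exact: val_inj.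
Qed.

Lemma outcome_transform T1 T2 (e f : 'cV[R]_3) Phi :
  outcome e (T1 *m Phi *m T2^T) f = outcome (T1^T *m e) Phi (T2^T *m f).
Proof. by rewrite /outcome trmx_mul trmxK !mulmxA. Qed.

Lemma outcomes_transform g h Phi : g \in hex_syms -> h \in hex_syms ->
  forall i j, (i < 6)%N -> (j < 6)%N ->
  outcomes (sym_transformation g *m Phi *m (sym_transformation h)^T) (6 * i + j) =
  outcomes Phi (6 * effect_perm g i + effect_perm h j).
Proof.
move=> gs hs i j i6 j6; rewrite !outcomesE ?effect_perm_lt// outcome_transform.
by rewrite !sym_transformation_effect.
Qed.

Lemma max_tensor_states_transform T1 T2 Phi : reversible T1 -> reversible T2 ->
  max_tensor_states Phi -> max_tensor_states (T1 *m Phi *m T2^T).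
Proof.
move=> /reversibleP[g gs ->] /reversibleP[h hs ->] /max_tensor_statesP[u p].
apply/max_tensor_statesP; split.
  by rewrite outcome_transform !sym_transformation_unit.
move=> n; rewrite mem_iota /= add0n => n36.
have -> : n = (6 * (n %/ 6) + n %% 6)%N by lia.
rewrite outcomes_transform//; try lia.
apply: p; rewrite mem_iota.
have := effect_perm_lt g (n %/ 6); have := effect_perm_lt h (n %% 6); lia.
Qed.

Lemma ray_vec_act g h s i j : (i < 6)%N -> (j < 6)%N ->
  vec (act g h s) (6 * i + j) = vec s (6 * effect_perm g i + effect_perm h j).
Proof. by move=> i6 j6; rewrite /act ray_vec_table. Qed.

Lemma zeros_eqP s t : zeros s = zeros t <-> {in iota 0 36, forall n, vec s n = 0 <-> vec t n = 0}.
Proof.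
rewrite /zeros /zero_mask; split=> [/eq_in_map h n /h|h].
  rewrite -!(of_Z_eq0 R) -/(vec s n) -/(vec t n) => e.
  by split=> /eqP z; apply/eqP; [rewrite -e|rewrite e].
apply/eq_in_map => n /h [h1 h2]; rewrite -!(of_Z_eq0 R).
by apply/eqP/eqP.
Qed.

(** The product is [(r6^2 cos t + 1) / 2] for the angle [t] between effect and state, and
    [r6^2 sqrt 3 = 2] makes [r6^2 cos t] equal to 1, 0 or -1. *)
Lemma effect_pure_state i a : (i < 6)%N -> (a <= 6)%N ->
  (effect R i.+1)^T *m pure_state R a =
  (zr (nth Z0 [:: 2; 1; 0; 0; 1; 2]%ZZ (effect_perm (a, true) i)) / 2)%:M.
Proof.
move=> i6 a6; have [ec _ _ _] := effect_angle_perm R i6 a6.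
apply/matrixP => x y; rewrite !ord1 !mxE !big_ord_recl big_ord0 !mxE /= mulr1n.
set t := nth Z0 _ _.
transitivity (2^-1 * (r ^+ 2 * cos (effect_angle R i - 2 * pi * a%:R / 6) + 1)).
  by rewrite cosB /effect_angle; ring.
rewrite ec /t; have := effect_perm_lt (a, true) i; move: (effect_perm _ _) => m m6.
rewrite cos_effect_angle//; have rq := sqr_r6_sqrt3 R.
have z1 : zr 1%ZZ = 1 by []. have z2 : zr 2%ZZ = 2 by [].
by move: m m6 => [|[|[|[|[|[|//]]]]]] _ /=; rewrite ?z1 ?z2 ?of_Z0; lra.
Qed.

Lemma outcomes_product a b : hex_index a -> hex_index b ->
  outcomes (pure_state R a *m (pure_state R b)^T) = fun n => 4^-1 * vec (product_ray a b) n.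
Proof.
move=> /andP[_ a6] /andP[_ b6]; apply: table_eq => [n|n n36|i j i6 j6].
- exact: outcomes_default.
- by rewrite ray_vec_default ?mulr0.
rewrite outcomesE// /product_ray ray_vec_table// of_ZM /outcome mulmxA effect_pure_state//.
rewrite -mulmxA -[(pure_state R b)^T *m _]trmxK trmx_mul trmxK effect_pure_state//.
by rewrite tr_scalar_mx -scalar_mxM mxE mulr1n; field.
Qed.

Lemma max_tensor_states_product a b : hex_index a -> hex_index b ->
  max_tensor_states (pure_state R a *m (pure_state R b)^T).
Proof.
move=> ha hb; apply/max_tensor_statesP; split.
  by rewrite outcome_unitE !mxE big_ord1 !mxE /= mulr1.
move=> n kn; rewrite outcomes_product// mulr_ge0 ?invr_ge0 ?ler0n// ray_vecE of_Z_ge0.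
have /allP := product_rays_ge0; move=> /(_ (product_ray a b)) h.
have {}h : nonneg_at (iota 0 36) (product_ray a b).
  by apply: h; apply/allpairsP; exists (a, b); rewrite !mem_iota.
by have /allP := h; apply.
Qed.

(** The powers of [r6] in the matrix cancel those in the effects, leaving only sines and cosines. *)
Lemma outcomes_mx3 a b c d e f g h i j : (i < 6)%N -> (j < 6)%N ->
  outcomes (mx3 [:: [:: a / r ^+ 2; b / r ^+ 2; c / r]; [:: d / r ^+ 2; e / r ^+ 2; f / r];
                    [:: g / r; h / r; 1]]) (6 * i + j) =
  4^-1 * (cos (effect_angle R i) * (a * cos (effect_angle R j) + b * sin (effect_angle R j) + c)
        + sin (effect_angle R i) * (d * cos (effect_angle R j) + e * sin (effect_angle R j) + f)
        + g * cos (effect_angle R j) + h * sin (effect_angle R j) + 1).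
Proof.
move=> i6 j6; rewrite outcomesE// !effectE outcomeZl outcomeZr /outcome.
rewrite !mxE !big_ord_recl !big_ord0 !mxE !big_ord_recl !big_ord0 !mxE /=.
by field; rewrite r6_neq0.
Qed.

(* The entries of the representatives, row by row, multiplied by [r ^+ 2] in the upper
   left block and by [r] in the last row and column; the last entry is always 1. *)
Definition scaled_representatives : seq (seq R) := let p := r ^+ 2 in
  [:: [:: 1; p / 2; 0; p / 2; - 1; 0; 0; 0];
      [:: 1 / 15; 7 / 10 * p; q / 3; 7 / 10 * p; 1 / 5; 3 / 5; q / 3; 3 / 5];
      [:: 1 / 3; q / 2; q / 3; q / 2; 0; 1 / 2; q / 3; 1 / 2];
      [:: 1 / 7; 9 / 14 * p; 5 * q / 21; 11 / 14 * p; 1 / 7; 5 / 7; 3 * q / 7; 3 / 7];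
      [:: 1 / 7; 11 / 14 * p; 3 * q / 7; 9 / 14 * p; 1 / 7; 3 / 7; 5 * q / 21; 5 / 7];
      [:: - 1 / 2; - q / 2; q / 6; - q / 2; 1 / 2; - 1 / 2; q / 6; - 1 / 2]].

Lemma representative_scaled (i : 'I_6) : let s := nth [::] scaled_representatives i in
  representative R i = mx3 [:: [:: s`_0 / r ^+ 2; s`_1 / r ^+ 2; s`_2 / r];
    [:: s`_3 / r ^+ 2; s`_4 / r ^+ 2; s`_5 / r]; [:: s`_6 / r; s`_7 / r; 1]].
Proof.
have rn := r6_neq0 R.
have qE : q = 2 / r ^+ 2 by rewrite -(sqr_r6_sqrt3 R) mulrAC divff ?mul1r// expf_neq0.
move: i => [[|[|[|[|[|[|//]]]]]] hi]; apply/matrixP => -[[|[|[|//]]] hx] -[[|[|[|//]]] hy];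
  by rewrite /representative /= !mxE /= ?qE; field.
Qed.

(* The denominators cleared in [representative_rays]. *)
Definition weights : seq R := [:: 4; 20; 16; 28; 28; 8].

Lemma outcomes_representative (i : 'I_6) :
  outcomes (representative R i) = fun n => (weights`_i)^-1 * vec (nth [::] representative_rays i) n.
Proof.
have /allP ck := representative_rays_check.
have cs : consistent (vec (nth [::] representative_rays i)).
  have ri : nth [::] representative_rays i \in representative_rays.
    by apply: mem_nth; exact: ltn_ord.
  by have /andP[/consistent_vec] := ck _ ri.
have := consistent_lin (weights`_i)^-1 0 cs cs.
set x := fun n => (weights`_i)^-1 * vec (nth [::] representative_rays i) n.
rewrite (_ : (fun n => _) = x); last by apply/funext => n; rewrite mul0r addr0.
(* Both tables satisfy the linear relations, so only the nine basis positions need to be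
   compared. *)
move=> /(consistent_eq (consistent_outcomes _)); apply => a b a3 b3.
have -> : (12 * a + 2 * b = 6 * (2 * a) + 2 * b)%N by lia.
rewrite /x {x} representative_scaled outcomes_mx3; try lia.
rewrite !cos_effect_angle ?sin_effect_angle; try lia.
have q2 := sqr_sqrt3 R.
have rq : r ^+ 2 = 2 / 3 * q.
  have := sqr_r6_sqrt3 R; move: (r ^+ 2) => p pq.
  have : p * (q * q) = 2 * q by rewrite mulrA pq.
  by rewrite q2; lra.
move: i {cs ck} => [[|[|[|[|[|[|//]]]]]] hi]; move: a b a3 b3 => [|[|[|//]]] [|[|[|//]]] _ _;
  rewrite /scaled_representatives /weights /= ray_vecE ?rq /=;
  (* The entries are nonnegative, so [Z.to_nat] loses nothing and turns them into numerals that
     [nra] can read. *)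
  (let z := match goal with |- context [of_Z _ ?z] => z end in
   let n := eval vm_compute in (Z.to_nat z) in
   have -> : zr z = n%:R by []);
  nra.
Qed.

End States.

(** * Local equivalence *)

Section Group.
Variable R : realType.
Implicit Types (Phi Psi T : 'M[R]_3).

(** The dihedral group law: a reflection on the left reverses the second angle. The index is not
    reduced modulo 6; [reversible_hex] does that. *)
Lemma hex_transformation_mul k l (b c : bool) : (l <= 6)%N ->
  hex_transformation k ((-1) ^+ (~~ b)) *m hex_transformation l ((-1) ^+ (~~ c)) =
  hex_transformation (if b then k + l else k + 6 - l)%N ((-1) ^+ (~~ (b == c))) :> 'M[R]_3.
Proof.
move=> l6; rewrite /hex_transformation.
set x := 2 * pi * k%:R / 6; set y := 2 * pi * l%:R / 6.
set m := (if b then _ else _)%N.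
have [ec es] : cos (2 * pi * m%:R / 6) = cos (x + (-1) ^+ (~~ b) * y) /\
    sin (2 * pi * m%:R / 6) = sin (x + (-1) ^+ (~~ b) * y).
  rewrite /m {m}.
  case: b => /=.
    by rewrite natrD mul1r mulrDr mulrDl.
  rewrite mulN1r -(cosD2pi (x - y)) -(sinD2pi (x - y)).
  have -> : 2 * pi * (k + 6 - l)%N%:R / 6 = x - y + pi *+ 2; last by [].
  by rewrite natrB ?natrD /x /y ?mulr2n; [field|lia].
rewrite ec es {ec es m}; apply/matrixP => i j; rewrite !mxE !big_ord_recl big_ord0 !mxE /=.
case: b c => [] []; rewrite /= ?mul1r ?mulN1r ?(cosD, sinD, cosN, sinN);
  by move: i j => [[|[|[|//]]] hi] [[|[|[|//]]] hj] /=; ring.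
Qed.

Lemma reversible_hex n (b : bool) : reversible (hex_transformation n ((-1) ^+ (~~ b)) : 'M[R]_3).
Proof.
(* This is the residue of [n] modulo 6 taken in the range 1 to 6. *)
exists ((n + 5) %% 6).+1, ((-1) ^+ (~~ b)); split.
- by rewrite /hex_index ltn_pmod.
- by case: b; [left|right].
- rewrite /hex_transformation.
  have e : 2 * pi * n%:R / 6 + pi *+ 2 =
      2 * pi * ((n + 5) %% 6).+1%:R / 6 + pi *+ 2 *+ ((n + 5) %/ 6) :> R.
    have /(congr1 (fun m => m%:R : R)) : (n + 6 = (n + 5) %/ 6 * 6 + ((n + 5) %% 6).+1)%N by lia.
    rewrite !natrD natrM => h; rewrite -[pi *+ 2 *+ _]mulr_natr mulr2n.
    have -> : n%:R = ((n + 5) %/ 6)%:R * 6 + ((n + 5) %% 6).+1%:R - 6 :> R by rewrite -h addrK.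
    by field.
  have ec : cos (2 * pi * n%:R / 6) = cos (2 * pi * ((n + 5) %% 6).+1%:R / 6) :> R.
    by rewrite -cosD2pi e (periodicn (@cosD2pi R)).
  have es : sin (2 * pi * n%:R / 6) = sin (2 * pi * ((n + 5) %% 6).+1%:R / 6) :> R.
    by rewrite -sinD2pi e (periodicn (@sinD2pi R)).
  by rewrite ec es.
Qed.

Lemma reversible_mul T1 T2 : reversible T1 -> reversible T2 -> reversible (T1 *m T2).
Proof.
move=> /reversibleP[[k b] _ ->] /reversibleP[[l c]].
rewrite mem_hex_syms => /andP[_ /= l6] ->.
by rewrite /sym_transformation /= hex_transformation_mul//; exact: reversible_hex.
Qed.

Lemma hex_transformation6 : hex_transformation 6 1 = 1%:M :> 'M[R]_3.
Proof.
have e : 2 * pi * 6%:R / 6 = pi *+ 2 :> R by rewrite mulr2n; field.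
rewrite /hex_transformation e cos2pi sin2pi; apply/matrixP => i j; rewrite !mxE.
by move: i j => [[|[|[|//]]] hi] [[|[|[|//]]] hj] /=; rewrite ?mulr1n ?mulr0n; ring.
Qed.

Lemma reversible1 : reversible (1%:M : 'M[R]_3).
Proof. by rewrite -hex_transformation6; exact: (reversible_hex 6 true). Qed.

(** Rotations are inverted by [6 - k], and reflections are involutions. *)
Lemma reversible_inv T : reversible T -> exists2 T', reversible T' & T' *m T = 1%:M.
Proof.
move=> /reversibleP[[k b]]; rewrite mem_hex_syms => /andP[_ /= k6] ->.
exists (hex_transformation (if b then 6 - k else k)%N ((-1) ^+ (~~ b))).
  exact: reversible_hex.
rewrite /sym_transformation /= hex_transformation_mul// eqxx /= -hex_transformation6.
by case: b; congr (hex_transformation _ _); lia.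
Qed.

Lemma locally_equivalent_sym Phi Psi : locally_equivalent Phi Psi -> locally_equivalent Psi Phi.
Proof.
move=> [T1 [T2 [r1 r2 ->]]].
have [S1 s1 e1] := reversible_inv r1; have [S2 s2 e2] := reversible_inv r2.
exists S1, S2; split=> //.
by rewrite !mulmxA e1 mul1mx -mulmxA -trmx_mul e2 trmx1 mulmx1.
Qed.

Lemma locally_equivalent_trans Phi Psi Xi :
  locally_equivalent Phi Psi -> locally_equivalent Psi Xi -> locally_equivalent Phi Xi.
Proof.
move=> [T1 [T2 [r1 r2 ->]]] [S1 [S2 [s1 s2 ->]]].
exists (S1 *m T1), (S2 *m T2); split; [exact: reversible_mul..|].
by rewrite trmx_mul !mulmxA.
Qed.

End Group.

(** * The representatives and the classification *)

Section Main.
Variable R : realType.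
Local Notation vec := (ray_vec R).
Local Notation rep_ray i := (nth [::] representative_rays i).
Implicit Types (Phi Psi T : 'M[R]_3).

Lemma representative_ray_mem (i : 'I_6) : rep_ray i \in representative_rays.
Proof. by apply: mem_nth; exact: ltn_ord. Qed.

Lemma weights_gt0 (i : 'I_6) : 0 < (weights R)`_i.
Proof. by move: i => [[|[|[|[|[|[|//]]]]]] hi] /=; rewrite ltr0n. Qed.

Lemma max_tensor_states_representative i : max_tensor_states (representative R i).
Proof.
apply/max_tensor_statesP; split.
  by rewrite outcome_unitE; move: i => [[|[|[|[|[|[|//]]]]]] hi]; rewrite mxE.
move=> n kn; rewrite outcomes_representative mulr_ge0 ?invr_ge0 ?(ltW (weights_gt0 i))//.
have /allP/(_ _ (representative_ray_mem i))/andP[_ /allP h] := representative_rays_check.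
by rewrite ray_vecE of_Z_ge0; exact: h.
Qed.

Lemma outcomes_representative_eq0 i n :
  outcomes (representative R i) n = 0 <-> vec (rep_ray i) n = 0.
Proof.
rewrite outcomes_representative; split=> [/eqP|->]; last by rewrite mulr0.
by rewrite mulf_eq0 invr_eq0 gt_eqF ?weights_gt0//= => /eqP.
Qed.

Lemma ray_of_zeros (i : 'I_6) s : s \in rays -> covers (iota 0 36) (vec (rep_ray i)) (vec s) ->
  s = rep_ray i.
Proof.
move=> sK cov; have [_ h] := rays_checkP rays_check_rays.
have {}h := h _ s (representative_ray_mem i) sK; apply: h.
by apply/(@meet_subP R) => n kn rn _; exact: cov.
Qed.

(** Both ends of a segment through the representative vanish at its zeros; the only ray of the list
    with these zeros is its own, so each end is proportional to it, and normalization gives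
    equality. *)
Lemma representative_extreme i : extreme_points (@max_tensor_states R) (representative R i).
Proof.
split=> [|y z t sy sz /andP[t0 t1] e]; first exact: max_tensor_states_representative.
have main x : max_tensor_states x ->
    covers (iota 0 36) (outcomes (representative R i)) (outcomes x) ->
    x = representative R i.
  move=> sx cov; apply: outcomes_inj.
  have [c xc] : exists c, outcomes x = fun n => c * vec (rep_ray i) n.
    apply: (cone_ray (@rays_ge0 R) _ (state_cone sx)).
      by move=> _ [s sK ->] /(ray_of_zeros sK) ->.
    by move=> n kn rn; apply: cov => //; apply/outcomes_representative_eq0.
  have [u _] := sx; have [u' _] := max_tensor_states_representative i.
  move: u u'; rewrite !outcome_unit xc outcomes_representative.
  set w := (weights R)`_i.
  set S := \sum_(a < 3) \sum_(b < 3) vec (rep_ray i) (12 * a + 2 * b)%N.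
  have lin d : \sum_(a < 3) \sum_(b < 3) d * vec (rep_ray i) (12 * a + 2 * b)%N = d * S.
    by rewrite mulr_sumr; apply: eq_bigr => a _; rewrite mulr_sumr.
  rewrite !lin => u u'.
  have S0 : 4 / 9 * S != 0.
    by apply/eqP => S0; move: u; rewrite mulrCA S0 mulr0 => /esym/eqP; rewrite oner_eq0.
  have -> // : c = w^-1.
  by apply: (mulIf S0); rewrite ![_ * (4 / 9 * S)]mulrCA u u'.
have nn n : n \in iota 0 36 -> outcomes (representative R i) n = 0 ->
    outcomes y n = 0 /\ outcomes z n = 0.
  move=> kn; rewrite e outcomes_comb => /eqP.
  have /max_tensor_statesP[_ yp] := sy; have /max_tensor_statesP[_ zp] := sz.
  have t1' : 0 < 1 - t by rewrite subr_gt0.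
  rewrite paddr_eq0 ?mulr_ge0 ?yp ?zp ?(ltW t0) ?(ltW t1')//.
  by rewrite !mulf_eq0 (gt_eqF t0) (gt_eqF t1')/= => /andP[/eqP -> /eqP ->].
by split; apply: main => // n kn /(nn n kn)[].
Qed.

Lemma zeros_outcomes Phi Psi s t c d : c != 0 -> d != 0 ->
  outcomes Phi = (fun n => c * vec s n) -> outcomes Psi = (fun n => d * vec t n) ->
  Phi = Psi -> zeros s = zeros t.
Proof.
move=> c0 d0 eP eQ e; apply/(@zeros_eqP R) => n _.
have := congr1 (fun A => outcomes A n) e; rewrite /= eP eQ => h.
split=> z; apply/eqP.
  by have /esym/eqP := h; rewrite z mulr0 mulf_eq0 (negPf d0).
by have /eqP := h; rewrite z mulr0 mulf_eq0 (negPf c0).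
Qed.

Lemma representative_extreme_entangled i : extreme_entangled (representative R i).
Proof.
split; first exact: representative_extreme.
move=> [a [b [ha hb e]]].
have /allP/(_ _ (representative_ray_mem i))/negP := product_rays_check; apply.
have w0 : ((weights R)`_i)^-1 != 0 by rewrite invr_eq0 gt_eqF ?weights_gt0.
have q0 : 4^-1 != 0 :> R by rewrite invr_eq0 pnatr_eq0.
rewrite (zeros_outcomes w0 q0 (outcomes_representative R i) (outcomes_product R ha hb) e).
by apply/map_f/allpairsP; exists (a, b); rewrite !mem_iota.
Qed.

Lemma outcomes_transform_representative g h i : g \in hex_syms -> h \in hex_syms ->
  outcomes (sym_transformation R g *m representative R i *m (sym_transformation R h)^T) =
  fun n => ((weights R)`_i)^-1 * vec (act g h (rep_ray i)) n.
Proof.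
move=> gs hs; apply: table_eq => [n|n n36|j k j6 k6]; first exact: outcomes_default.
  by rewrite ray_vec_default ?mulr0.
by rewrite outcomes_transform// outcomes_representative ray_vec_act.
Qed.

Lemma locally_equivalent_representative i j :
  locally_equivalent (representative R i) (representative R j) -> i = j.
Proof.
move=> [T1 [T2 [/reversibleP[g gs ->] /reversibleP[h hs ->] e]]].
apply/val_inj/eqP.
have ii : val i \in iota 0 6 by rewrite mem_iota ltn_ord.
have jj : val j \in iota 0 6 by rewrite mem_iota ltn_ord.
have /allP/(_ _ ii)/allP/(_ _ jj)/orP[//|/negP[]] := orbits_check.
have w0 (k : 'I_6) : ((weights R)`_k)^-1 != 0 by rewrite invr_eq0 gt_eqF ?weights_gt0.
rewrite (zeros_outcomes (w0 j) (w0 i) (outcomes_representative R j)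
  (outcomes_transform_representative i gs hs) e).
by apply/map_f/allpairsP; exists (g, h).
Qed.

Lemma extreme_entangled_equivalent Phi : extreme_entangled Phi ->
  exists i, locally_equivalent (representative R i) Phi.
Proof.
move=> [ext nprod]; have [s sK cov] := state_covered ext.1.
have [/(_ s sK) + _] := rays_checkP rays_check_rays.
rewrite mem_cat => /orP[/allpairsP[[a b] [ha hb es]]|/flattenP[l /mapP[r rr ->]]].
  have {}ha : hex_index a by move: ha; rewrite mem_iota.
  have {}hb : hex_index b by move: hb; rewrite mem_iota.
  (* If a product ray covers [Phi], extremality makes [Phi] that product state, against
     entanglement. *)
  case: nprod; exists a, b; split; [exact: ha|exact: hb|apply/esym].
  apply: (extreme_state_covered ext); first exact: max_tensor_states_product.
  have {}es : s = product_ray a b := es.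
  move=> n kn /(cov n kn) z.
  by rewrite (outcomes_product R ha hb) -es z mulr0.
move=> /allpairsP[[g h] [/= gs hs es]].
have ri : (index r representative_rays < 6)%N.
  by rewrite -[6%N]/(size representative_rays) index_mem.
exists (Ordinal ri), (sym_transformation R g), (sym_transformation R h).
have rg : reversible (sym_transformation R g) by apply/reversibleP; exists g.
have rh : reversible (sym_transformation R h) by apply/reversibleP; exists h.
split; [exact: rg|exact: rh|apply/esym].
apply: (extreme_state_covered ext).
  exact/max_tensor_states_transform/max_tensor_states_representative.
move=> n kn /(cov n kn) z.
rewrite (outcomes_transform_representative (Ordinal ri) gs hs) [rep_ray _](nth_index _ rr).
by rewrite -[act g h r]es z mulr0.
Qed.

Lemma entangled_class_eq Phi Psi : locally_equivalent Phi Psi ->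
  entangled_class Phi = entangled_class Psi.
Proof.
move=> e; apply/seteqP; split=> X [eX h]; split=> //; last exact: locally_equivalent_trans e h.
exact: locally_equivalent_trans (locally_equivalent_sym e) h.
Qed.

Lemma entangled_class_representative i j :
  entangled_class (representative R i) (representative R j) <-> i = j.
Proof.
split=> [[_ /locally_equivalent_representative//]|->].
split; first exact: representative_extreme_entangled.
exists 1%:M, 1%:M; split; [exact: reversible1..|by rewrite trmx1 mulmx1 mul1mx].
Qed.

End Main.

Local Open Scope card_scope.

Theorem mainTheorem10 (R : realType) :
  [/\ entangled_classes R #= `I_6,
      forall i : 'I_6, extreme_entangled (representative R i) &
      forall C : set 'M[R]_3, entangled_classes R C ->
        exists! i : 'I_6, C (representative R i)].
Proof.
split.
(* The classes are the image of the six indices, and the map from indices to classes is injective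
   because no class contains two representatives. *)
- have -> : entangled_classes R =
      (fun n => entangled_class (representative R (inord n))) @` `I_6.
    apply/seteqP; split=> [_ [Phi ePhi <-]|_ [n _ <-]].
      have [i /entangled_class_eq <-] := extreme_entangled_equivalent ePhi.
      by exists (val i); [exact: ltn_ord|rewrite inord_val].
    exists (representative R (inord n)) => //; exact: representative_extreme_entangled.
  apply: inj_card_eq => m n /set_mem /= m6 /set_mem /= n6 e.
  rewrite -[m](@inordK 5)// -[n](@inordK 5)//; congr val.
  apply/(entangled_class_representative R).
  by rewrite e; apply/entangled_class_representative.
- exact: representative_extreme_entangled.
- move=> _ [Phi ePhi <-]; have [i ei] := extreme_entangled_equivalent ePhi.
  rewrite -(entangled_class_eq ei); exists i; split.
    exact/entangled_class_representative.
  by move=> j /entangled_class_representative.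
Qed.
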